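(* Let $B$ be a $C^*$-algebra and let $S$ and $T$ be weakly commuting (regular self-adjoint) operators on a Hilbert $B$-module $E$. Then $S+T$ is essentially self-adjoint on $\mathrm{Dom}\,S\cap\mathrm{Dom}\,T$.
   Context: Let $S,T$ be regular self-adjoint operators on a Hilbert $B$-module $E$ with $\mathrm{Dom}\,S\cap\mathrm{Dom}\,T$ dense. For $x,y\in\mathrm{Dom}\,S\cap\mathrm{Dom}\,T$ put $$\langle x|y\rangle_{S,T}:=\langle x|y\rangle+\langle Sx|Sy\rangle+\langle Tx|Ty\rangle .$$ The commutator $[S,T]_-=ST-TS$ has the natural initial domain $$\mathrm{Dom}([S,T]_-)=\{x\in\mathrm{Dom}\,S\cap\mathrm{Dom}\,T: Sx\in\mathrm{Dom}\,T \text{ and } Tx\in\mathrm{Dom}\,S\}.$$ The operators $S$ and $T$ are called weakly commuting if: (1) there is a constant $C>0$ such that $\langle [S,T]_-x\,|\,[S,T]_-x\rangle\leq C\langle x|x\rangle_{S,T}$ for all $x\in\mathrm{Dom}([S,T]_-)$; (2) there are a core $\mathcal{E}\subset\mathrm{Dom}\,T$ for $T$ and a constant $\lambda_0>0$ such that $(S+\lambda)^{-1}(\mathcal{E})\subset\mathrm{Dom}([S,T]_-)$ for all $\lambda\in i\mathbb{R}$ with $|\lambda|\geq\lambda_0$. A densely defined symmetric operator on $E$ is essentially self-adjoint if its closure is self-adjoint (no regularity of the closure is asserted). *)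

(* Defs.v *)
From HB Require Import structures.
From mathcomp Require Import all_boot all_order all_algebra.
From mathcomp Require Import all_classical all_reals all_analysis.
From mathcomp Require Import complex.

Set Implicit Arguments.
Unset Strict Implicit.
Unset Printing Implicit Defensive.

Import Order.TTheory GRing.Theory Num.Theory.
Import numFieldNormedType.Exports.

Local Open Scope classical_set_scope.
Local Open Scope ring_scope.
Local Open Scope complex_scope.

(* C*-algebras need not be unital, hence are not built on MathComp rings.
   The norm of a normed module over R[i] takes its values in R[i] (in fact
   among the nonnegative reals). *)
HB.mixin Record isCStarAlgebra (R : realType) B
    of CompleteNormedModule R[i] B := {
  cmul : B -> B -> B;
  cstar : B -> B;
  cmulA : forall x y z : B, cmul x (cmul y z) = cmul (cmul x y) z;
  cmulDl : forall x y z : B, cmul (x + y) z = cmul x z + cmul y z;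
  cmulDr : forall x y z : B, cmul x (y + z) = cmul x y + cmul x z;
  cscaleAl : forall (a : R[i]) (x y : B), cmul (a *: x) y = a *: cmul x y;
  cscaleAr : forall (a : R[i]) (x y : B), cmul x (a *: y) = a *: cmul x y;
  cstarK : forall x : B, cstar (cstar x) = x;
  cstarD : forall x y : B, cstar (x + y) = cstar x + cstar y;
  cstarZ : forall (a : R[i]) (x : B), cstar (a *: x) = a^* *: cstar x;
  cstarM : forall x y : B, cstar (cmul x y) = cmul (cstar y) (cstar x);
  normr_cmul : forall x y : B, `|cmul x y| <= `|x| * `|y|;
  cstar_identity : forall x : B, `|cmul (cstar x) x| = `|x| ^+ 2
}.

#[short(type="cstarAlgType")]
HB.structure Definition CStarAlgebra (R : realType) :=
  {B of isCStarAlgebra R B & CompleteNormedModule R[i] B}.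

Definition cpos (R : realType) (B : cstarAlgType R) (a : B) : Prop :=
  exists b : B, a = cmul (cstar b) b.

Definition cle (R : realType) (B : cstarAlgType R) (a b : B) : Prop :=
  cpos (b - a).

(* A right module whose B-valued inner product is linear in the second
   variable; [normr_inner] says that the norm for which E is complete is the
   one induced by the inner product. *)
HB.mixin Record isHilbertModule (R : realType) (B : cstarAlgType R) E
    of CompleteNormedModule R[i] E := {
  ract : E -> B -> E;
  inner : E -> E -> B;
  ractDl : forall (x y : E) (b : B), ract (x + y) b = ract x b + ract y b;
  ractDr : forall (x : E) (b c : B), ract x (b + c) = ract x b + ract x c;
  ractA : forall (x : E) (b c : B), ract x (cmul b c) = ract (ract x b) c;
  ractZl : forall (a : R[i]) (x : E) (b : B), ract (a *: x) b = a *: ract x b;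
  ractZr : forall (a : R[i]) (x : E) (b : B), ract x (a *: b) = a *: ract x b;
  innerDr : forall x y z : E, inner x (y + z) = inner x y + inner x z;
  innerZr : forall (a : R[i]) (x y : E), inner x (a *: y) = a *: inner x y;
  inner_ractr : forall (x y : E) (b : B),
    inner x (ract y b) = cmul (inner x y) b;
  inner_star : forall x y : E, cstar (inner x y) = inner y x;
  inner_pos : forall x : E, cpos (inner x x);
  inner_eq0 : forall x : E, inner x x = 0 -> x = 0;
  normr_inner : forall x : E, `|x| ^+ 2 = `|inner x x|
}.

#[short(type="hilbertModType")]
HB.structure Definition HilbertModule (R : realType) (B : cstarAlgType R) :=
  {E of isHilbertModule R B E & CompleteNormedModule R[i] E}.

Notation "⟨ x | y ⟩" := (inner x y)
  (at level 0, x at level 69, y at level 69) : ring_scope.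

Record submodule (R : realType) (B : cstarAlgType R) (E : hilbertModType B)
    (D : set E) : Prop := {
  submodule0 : D 0;
  submoduleD : forall x y, D x -> D y -> D (x + y);
  submoduleZ : forall (a : R[i]) x, D x -> D (a *: x);
  submodule_ract : forall x (b : B), D x -> D (ract x b)
}.

(* The values of [opfun] outside [dom] are irrelevant: equality of operators is
   always expressed through their graphs. *)
Record operator (R : realType) (B : cstarAlgType R) (E : hilbertModType B) := {
  dom : set E;
  opfun :> E -> E;
  dom_submodule : submodule dom;
  opfunD : forall x y, dom x -> dom y -> opfun (x + y) = opfun x + opfun y;
  opfunZ : forall (a : R[i]) x, dom x -> opfun (a *: x) = a *: opfun x;
  opfun_ract : forall x (b : B), dom x -> opfun (ract x b) = ract (opfun x) b
}.

Section Operators.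
Context (R : realType) (B : cstarAlgType R) (E : hilbertModType B).
Implicit Types S T : operator E.

Definition graph T : set (E * E) := [set p | dom T p.1 /\ p.2 = T p.1].

Definition graph_on T (D : set E) : set (E * E) :=
  [set p | D p.1 /\ p.2 = T p.1].

Definition densely_defined T : Prop := dense (dom T).

Definition closed_operator T : Prop := closed (graph T).

Definition symmetric_operator T : Prop :=
  forall x y, dom T x -> dom T y -> ⟨T x | y⟩ = ⟨x | T y⟩.

(* The pairs (y, z) such that y is in Dom T^* and T^* y = z; this is the graph
   of an operator when T is densely defined. *)
Definition adjoint_graph T : set (E * E) :=
  [set p | forall x, dom T x -> ⟨T x | p.1⟩ = ⟨x | p.2⟩].

Definition is_adjoint T Tstar : Prop := graph Tstar = adjoint_graph T.

Definition is_closure T Tbar : Prop := graph Tbar = closure (graph T).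

Definition selfadjoint T : Prop := densely_defined T /\ is_adjoint T T.

Definition regular T : Prop :=
  [/\ densely_defined T, closed_operator T &
      exists Tstar : operator E,
        [/\ is_adjoint T Tstar, densely_defined Tstar &
            (* the range of 1 + T^* T *)
            dense [set y : E | exists x, [/\ dom T x, dom Tstar (T x) &
                                             y = x + Tstar (T x)]]]].

Definition essentially_selfadjoint T : Prop :=
  [/\ densely_defined T, symmetric_operator T &
      exists Tbar : operator E, is_closure T Tbar /\ selfadjoint Tbar].

Definition core T (D : set E) : Prop :=
  [/\ submodule D, D `<=` dom T & closure (graph_on T D) = graph T].

Lemma op_add_submodule S T : submodule (dom S `&` dom T).
Proof.
have [S0 SD SZ SB] := dom_submodule S; have [T0 TD TZ TB] := dom_submodule T.
split=> [//|x y [? ?] [? ?]|a x [? ?]|x b [? ?]].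
- by split; [apply: SD|apply: TD].
- by split; [apply: SZ|apply: TZ].
- by split; [apply: SB|apply: TB].
Qed.

Definition op_add_fun S T (x : E) : E := S x + T x.

Lemma op_add_funD S T x y : (dom S `&` dom T) x -> (dom S `&` dom T) y ->
  op_add_fun S T (x + y) = op_add_fun S T x + op_add_fun S T y.
Proof. by move=> [? ?] [? ?]; rewrite /op_add_fun !opfunD // addrACA. Qed.

Lemma op_add_funZ S T (a : R[i]) x : (dom S `&` dom T) x ->
  op_add_fun S T (a *: x) = a *: op_add_fun S T x.
Proof. by move=> [? ?]; rewrite /op_add_fun !opfunZ // scalerDr. Qed.

Lemma op_add_fun_ract S T x (b : B) : (dom S `&` dom T) x ->
  op_add_fun S T (ract x b) = ract (op_add_fun S T x) b.
Proof. by move=> [? ?]; rewrite /op_add_fun !opfun_ract // ractDl. Qed.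

(* S + T on Dom S ∩ Dom T *)
Definition op_add S T : operator E :=
  @Build_operator R B E (dom S `&` dom T) (op_add_fun S T)
    (op_add_submodule S T) (@op_add_funD S T) (@op_add_funZ S T)
    (@op_add_fun_ract S T).

Definition inner2 S T (x y : E) : B :=
  ⟨x | y⟩ + ⟨S x | S y⟩ + ⟨T x | T y⟩.

Definition commutator S T (x : E) : E := S (T x) - T (S x).

Definition commutator_dom S T : set E :=
  [set x | [/\ dom S x, dom T x, dom T (S x) & dom S (T x)]].

(* (S + lam)^-1 (D), as a preimage *)
Definition resolvent_image S (lam : R[i]) (D : set E) : set E :=
  [set x | dom S x /\ D (S x + lam *: x)].

Definition weakly_commuting S T : Prop :=
  (exists2 C : R, 0 < C & forall x, commutator_dom S T x ->
     cle ⟨commutator S T x | commutator S T x⟩ (C%:C *: inner2 S T x x)) /\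
  (exists D : set E, core T D /\
     exists2 lam0 : R, 0 < lam0 & forall lam : R[i],
       complex.Re lam = 0 -> lam0%:C <= `|lam| ->
       resolvent_image S lam D `<=` commutator_dom S T).

End Operators.

(* Main.v *)
Require Import Defs.
From mathcomp Require Import all_boot all_order all_algebra.
From mathcomp Require Import all_classical all_reals all_analysis.
From mathcomp Require Import complex ring lra.

(* Write P_s = (S + i s)^-1 and Q_t = (T + i t)^-1 for real s, t.  The commutator
   bound gives |T P_s y| <= (2 / |s|) (|T y| + 2 C |y|), so for large |s| the
   resolvent P_s maps Dom T, and not only the core, into Dom [S, T].  Hence
   [S, T] P_s is T-bounded with small bound, 1 + [S, T] P_s Q_t is invertible by a
   Neumann series for large |t|, and so Q_t maps Dom S into Dom [S, T] as well.
   If (S + T)^* x = z, put x_(s,t) = i s P_s (i t Q_t) x, which lies in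
   Dom S and Dom T.  With w = P_s z - S P_s x one has <T P_(-s) y | x> = <y | w> on
   Dom T, and the commutator estimates give P_s T (i t Q_t) x -> w as t grows;
   then x_(s,t) -> x and (S + T) x_(s,t) -> z as first t and then s grow, so
   (S + T)^* is the closure of S + T.

   Turning the operator inequality on the commutator into a norm bound requires
   |x|^2 <= c |x^* x + z^* z| in a C*-algebra, hence the positivity of z^* z.  It is
   obtained without functional calculus, positivity of f being expressed by
   accretivity, |s v + f v| >= s |v|.  If x is small, r = (1 + x^* x)^-1 and
   r' = (1 + x x^* )^-1, then for odd N, up to a factor 2, r^N - r^2N and r'^N - r'^2N
   are sums over the same y of y^* y and y y^* respectively.  Since y^* y + y y^* is a sum of
   two self-adjoint squares and r'^N - r'^2N <= 1/4, the powers of r are bounded,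
   so |r| <= 1. *)

Set Implicit Arguments.
Unset Strict Implicit.
Unset Printing Implicit Defensive.

Import Order.TTheory GRing.Theory Num.Theory.
Import numFieldNormedType.Exports.

Local Open Scope classical_set_scope.
Local Open Scope ring_scope.
Local Open Scope complex_scope.

(** * Identities in modules *)

Section ModuleIdentities.
Context (K : nzRingType) (V : lmodType K).

(** Linear identities are proved by reflection: two terms agree in [V] as soon as the coefficients
    of each atom agree in [K], which leaves goals for [ring]. *)
Inductive lexpr :=
  | LVar of nat | LZero | LAdd of lexpr & lexpr | LOpp of lexpr
  | LScale of K & lexpr.

Fixpoint leval (env : seq V) (e : lexpr) : V :=
  match e with
  | LVar n => nth 0 env n
  | LZero => 0
  | LAdd e1 e2 => leval env e1 + leval env e2
  | LOpp e1 => - leval env e1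
  | LScale a e1 => a *: leval env e1
  end.

(** The test is [Nat.eqb] rather than [==] so that [cbn] reduces it on concrete indices. *)
Fixpoint lcoef (e : lexpr) (i : nat) : K :=
  match e with
  | LVar n => if Nat.eqb n i then 1 else 0
  | LZero => 0
  | LAdd e1 e2 => lcoef e1 i + lcoef e2 i
  | LOpp e1 => - lcoef e1 i
  | LScale a e1 => a * lcoef e1 i
  end.

Fixpoint lcoef_eq (e1 e2 : lexpr) (n : nat) : Prop :=
  match n with
  | 0 => True
  | m.+1 => lcoef e1 m = lcoef e2 m /\ lcoef_eq e1 e2 m
  end.

Lemma leval_sum env e :
  leval env e = \sum_(i < size env) lcoef e i *: nth 0 env i.
Proof.
elim: e => [n||e1 IH1 e2 IH2|e1 IH1|a e1 IH1] /=.
- have eqbE (i : nat) : Nat.eqb n i = (n == i) by apply/idP/eqP => /PeanoNat.Nat.eqb_eq.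
  have [nlt|nge] := ltnP n (size env).
    rewrite (bigD1 (Ordinal nlt)) //= eqbE eqxx scale1r big1 ?addr0 // => i.
    by rewrite eqbE -val_eqE /= eq_sym => /negbTE->; rewrite scale0r.
  rewrite nth_default // big1 // => i _; rewrite eqbE.
  by rewrite gtn_eqF ?scale0r // (leq_trans (ltn_ord i)).
- by rewrite big1 // => i _; rewrite scale0r.
- by rewrite IH1 IH2 -big_split; apply: eq_bigr => i _; rewrite scalerDl.
- by rewrite IH1 -sumrN; apply: eq_bigr => i _; rewrite scaleNr.
- by rewrite IH1 scaler_sumr; apply: eq_bigr => i _; rewrite scalerA.
Qed.

Lemma leval_eq env e1 e2 :
  lcoef_eq e1 e2 (size env) -> leval env e1 = leval env e2.
Proof.
move=> H; rewrite !leval_sum; apply: eq_bigr => -[i /= ilt] _; congr (_ *: _).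
elim: (size env) H ilt => // n IH /= [En /IH En']; rewrite ltnS leq_eqVlt.
by case/orP => [/eqP->|/En'].
Qed.

End ModuleIdentities.

(** Atoms are compared up to conversion, by typechecking [erefl x : x = y]; the match on [Set] with
    two wildcard branches supplies the backtracking. *)
Ltac mem_env x env :=
  lazymatch env with
  | nil => constr:(false)
  | ?y :: ?env' =>
    match constr:(Set) with
    | _ => let _ := constr:(erefl x : x = y) in constr:(true)
    | _ => mem_env x env'
    end
  end.

Ltac add_env x env :=
  let b := mem_env x env in
  lazymatch b with true => env | false => constr:(x :: env) end.

Ltac idx_env x env :=
  lazymatch env with
  | ?y :: ?env' =>
    match constr:(Set) with
    | _ => let _ := constr:(erefl x : x = y) in constr:(0%N)
    | _ => let n := idx_env x env' in constr:(n.+1)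
    end
  end.

Ltac collect_env e env :=
  lazymatch e with
  | 0%R => env
  | (?a + ?b)%R => let env' := collect_env a env in collect_env b env'
  | (- ?a)%R => collect_env a env
  | (_ *: ?a)%R => collect_env a env
  | _ => add_env e env
  end.

Ltac reify_mod K e env :=
  lazymatch e with
  | 0%R => constr:(@LZero K)
  | (?a + ?b)%R =>
    let a' := reify_mod K a env in
    let b' := reify_mod K b env in constr:(LAdd a' b')
  | (- ?a)%R => let a' := reify_mod K a env in constr:(LOpp a')
  | (?c *: ?a)%R => let a' := reify_mod K a env in constr:(@LScale K c a')
  | _ => let n := idx_env e env in constr:(@LVar K n)
  end.

Ltac lmod_with K :=
  lazymatch goal with
  | |- @eq ?T ?a ?b =>
    let env0 := collect_env a (@nil T) in
    let env := collect_env b env0 in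
    let a' := reify_mod K a env in
    let b' := reify_mod K b env in
    apply: (@leval_eq K _ env a' b');
    cbn [size lcoef_eq lcoef Nat.eqb];
    repeat (apply: conj; last first); try exact: I
  end.

(* Identities between linear combinations of vectors, coefficient by coefficient;
   a coefficient beyond the reach of [ring] is split into real and imaginary part. *)
Ltac lmod :=
  match goal with
  | R : realType |- _ => lmod_with R[i]
  end;
  first [ring | apply/eqP; rewrite eq_complex /=; apply/andP; split; apply/eqP;
  try ring; try (field; try lra)].

(** * Real-valued norms *)

Section RealNorm.
Context (R : realType).
Implicit Types V : normedModType R[i].

(** Norms over [R[i]] are complex numbers; the real part moves all estimates into [R], where [lra]
    and [nra] apply. *)
Definition nrm V (v : V) : R := complex.Re `|v|.

Lemma nrmE V (v : V) : `|v| = (nrm v)%:C.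
Proof. by rewrite /nrm RRe_real ?normr_real. Qed.

Lemma nrm_ge0 V (v : V) : 0 <= nrm v.
Proof. by rewrite -ler0c -nrmE. Qed.

Lemma nrm0 V : nrm (0 : V) = 0.
Proof. by apply: complexI; rewrite -nrmE normr0. Qed.

Lemma nrm0_eq0 V (v : V) : nrm v = 0 -> v = 0.
Proof. by move=> v0; apply/eqP; rewrite -normr_eq0 nrmE v0. Qed.

Lemma nrmD V (v w : V) : nrm (v + w) <= nrm v + nrm w.
Proof. by rewrite -lecR rmorphD /= -!nrmE ler_normD. Qed.

Lemma nrmN V (v : V) : nrm (- v) = nrm v.
Proof. by rewrite /nrm normrN. Qed.

Lemma nrmB V (v w : V) : nrm (v - w) <= nrm v + nrm w.
Proof. by rewrite -(nrmN w) nrmD. Qed.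

Lemma nrmBC V (v w : V) : nrm (v - w) = nrm (w - v).
Proof. by rewrite -nrmN opprB. Qed.

Lemma nrmZ V (a : R) (v : V) : nrm (a%:C *: v) = `|a| * nrm v.
Proof.
by apply: complexI; rewrite rmorphM /= -!nrmE normrZ normc_def /= expr0n addr0 sqrtr_sqr.
Qed.

Lemma nrmiZ V (v : V) : nrm ('i *: v) = nrm v.
Proof.
apply: complexI; rewrite -!nrmE normrZ normc_def /=.
by rewrite expr0n add0r expr1n sqrtr1 mul1r.
Qed.

End RealNorm.

(** * Closures, geometric convergence and the Neumann series *)

Section Topology.
Context (R : realType) (V : completeNormedModType R[i]).
Implicit Types (x y : V) (e : R).

Lemma near_nrm x e : 0 < e -> \forall y \near x, nrm (x - y) < e.
Proof.
move=> e0; have eC : 0 < e%:C by rewrite ltcR.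
have := nbhs_ball_norm x (PosNum eC); apply: filterS => y /=.
by rewrite nrmE ltcR.
Qed.

Lemma nbhs_nrm x (A : set V) :
  nbhs x A -> exists2 e, 0 < e & forall y, nrm (x - y) < e -> A y.
Proof.
move=> /nbhs_ballP[e /= e0 eA].
have eE : e = (complex.Re e)%:C by rewrite RRe_real // gtr0_real.
exists (complex.Re e); first by rewrite -ltcR -eE.
by move=> y xy; apply: eA; rewrite -ball_normE /= nrmE eE ltcR.
Qed.

Lemma dense_nrm (A : set V) x e :
  dense A -> 0 < e -> exists2 y, A y & nrm (x - y) < e.
Proof.
move=> dA e0; have xe := near_nrm x e0.
have [|y [/interior_subset ye Ay]] := dA _ _ (open_interior [set y | nrm (x - y) < e]).
  by exists x; exact: xe.
by exists y.
Qed.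

Lemma closure_nrm (A : set (V * V)) (p : V * V) :
  closure A p <-> (forall e, 0 < e ->
    exists q, [/\ A q, nrm (p.1 - q.1) < e & nrm (p.2 - q.2) < e]).
Proof.
case: p => x y; split=> [cA e e0|H C].
  have [|q [Aq [? ?]]] := cA [set q | nrm (x - q.1) < e /\ nrm (y - q.2) < e].
    exists ([set z | nrm (x - z) < e], [set z | nrm (y - z) < e]).
      by split; apply: near_nrm.
    by case.
  by exists q.
move=> [[A1 A2] /= [/nbhs_nrm[e1 e10 H1] /nbhs_nrm[e2 e20 H2]] sC].
have [|q [Aq q1 q2]] := H (Num.min e1 e2); first by rewrite lt_min e10.
exists q; split=> //; apply: sC; split.
  by apply: H1; apply: lt_le_trans q1 _; rewrite ge_min lexx.
by apply: H2; apply: lt_le_trans q2 _; rewrite ge_min lexx orbT.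
Qed.

Lemma expr_small (q e : R) : 0 <= q -> q < 1 -> 0 < e ->
  exists n0, forall n, (n0 <= n)%N -> q ^+ n < e.
Proof.
move=> q0 q1 e0.
have /cvgrPdist_lt/(_ _ e0)[n0 _ H] := @cvg_geometric R 1 q ltac:(by rewrite ger0_norm).
exists n0 => n /H /=; rewrite sub0r normrN /= mul1r.
by rewrite ger0_norm // exprn_ge0.
Qed.

Lemma geometric_complete (u : nat -> V) (K q : R) : 0 <= q -> q < 1 ->
  (forall n, nrm (u n.+1 - u n) <= K * q ^+ n) ->
  exists l, forall n, nrm (u n - l) <= K * q ^+ n / (1 - q).
Proof.
move=> q0 q1 Hu.
have p0 : 0 < 1 - q by rewrite subr_gt0.
have K0 : 0 <= K by have := Hu 0; rewrite mulr1; apply: le_trans (nrm_ge0 _).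
(* The exact partial sum of the geometric series; the bound without [1 - q ^+ m] would not pass
   through the induction. *)
have tele n m : nrm (u (n + m)%N - u n) <= K * q ^+ n * (1 - q ^+ m) / (1 - q).
  elim: m => [|m IH]; first by rewrite addn0 !subrr nrm0 mulr0 mul0r.
  have -> : u (n + m.+1)%N - u n = (u (n + m).+1 - u (n + m)%N) + (u (n + m)%N - u n).
    by rewrite addnS; lmod.
  apply: le_trans (nrmD _ _) _; apply: le_trans (lerD (Hu _) IH) _.
  rewrite le_eqVlt; apply/orP; left; apply/eqP.
  by rewrite exprD exprS; field; rewrite lt0r_neq0.
have bnd n m : nrm (u (n + m)%N - u n) <= K * q ^+ n / (1 - q).
  apply: le_trans (tele n m) _; rewrite ler_pM2r ?invr_gt0 //.
  by rewrite ler_piMr ?mulr_ge0 ?exprn_ge0 // gerBl exprn_ge0.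
have small e : 0 < e -> exists n, K * q ^+ n / (1 - q) < e.
  move=> e0.
  have [|n0 /(_ n0 (leqnn _)) H] := @expr_small q (e * (1 - q) / (K + 1)) q0 q1.
    by rewrite divr_gt0 ?mulr_gt0 // ltr_wpDl.
  exists n0; rewrite ltr_pdivrMr //.
  rewrite ltr_pdivlMr ?ltr_wpDl // in H; apply: le_lt_trans H.
  by rewrite mulrC ler_wpM2l ?exprn_ge0 // lerDl.
have cu : cauchy (u @ \oo).
  apply: cauchy_exP => e e0.
  have eE : e = (complex.Re e)%:C by rewrite RRe_real // gtr0_real.
  have [|n Hn] := small (complex.Re e); first by rewrite -ltcR -eE.
  exists (u n); exists n => // m /= nm.
  rewrite -ball_normE /= nrmE eE ltcR nrmBC.
  by rewrite -(subnKC nm); apply: le_lt_trans (bnd _ _) Hn.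
have /cauchy_cvg := cu => cvu.
exists (lim (u @ \oo)) => n; apply/ler_addgt0Pr => e e0.
have ne := near_nrm (lim (u @ \oo)) e0.
have [N _ HN] := cvu _ ne.
have := HN (n + N)%N (leq_addl _ _) => /= H.
have -> : u n - lim (u @ \oo) = (u n - u (n + N)%N) - (lim (u @ \oo) - u (n + N)%N) by lmod.
apply: le_trans (nrmB _ _) _; apply: lerD; first by rewrite nrmBC bnd.
exact: ltW.
Qed.

(** The iterates of u -> y - L u, started at 0, contract with ratio q, and their limit solves the
    equation. *)
Lemma neumann (L : V -> V) (q : R) (y : V) : 0 <= q -> q < 1 ->
  (forall x x', L (x - x') = L x - L x') -> (forall x, nrm (L x) <= q * nrm x) ->
  exists x, x + L x = y.
Proof.
move=> q0 q1 LB Lq.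
pose u := fix u n := if n is m.+1 then y - L (u m) else 0 : V.
have Hu n : nrm (u n.+1 - u n) <= nrm y * q ^+ n.
  elim: n => [|n IH].
    rewrite /= mulr1; have /eqP := nrm_ge0 (L 0); have := Lq 0; rewrite nrm0 mulr0 => H _.
    have -> : L 0 = 0 by apply: nrm0_eq0; apply/le_anti; rewrite H nrm_ge0.
    by rewrite !subr0.
  have -> : u n.+2 - u n.+1 = - L (u n.+1 - u n).
    by rewrite LB /=; lmod.
  rewrite nrmN; apply: le_trans (Lq _) _; rewrite exprS mulrCA.
  by rewrite ler_wpM2l.
have [l Hl] := geometric_complete q0 q1 Hu.
exists l; apply/eqP; rewrite -subr_eq0; apply/eqP/nrm0_eq0/le_anti.
rewrite nrm_ge0 andbT; apply/ler_addgt0Pr => e e0; rewrite add0r.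
have p0 : 0 < 1 - q by rewrite subr_gt0.
have y0 := nrm_ge0 y.
have [|n0 H] := @expr_small q (e * (1 - q) / (2 * (nrm y + 1))) q0 q1.
  by rewrite divr_gt0 ?mulr_gt0 // ltr_wpDl.
have Hn0 := ltW (H _ (leqnSn n0)); have {}H := ltW (H _ (leqnn _)).
have small n : q ^+ n <= e * (1 - q) / (2 * (nrm y + 1)) -> nrm (u n - l) <= e / 2.
  move=> Hq; apply: le_trans (Hl n) _; rewrite ler_pdivrMr //.
  rewrite ler_pdivlMr ?mulr_gt0 ?ltr_wpDl // in Hq.
  by have := exprn_ge0 n q0; nra.
have -> : l + L l - y = - (u n0.+1 - l) - L (u n0 - l).
  by rewrite LB /=; lmod.
apply: le_trans (nrmB _ _) _; rewrite nrmN.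
rewrite [leRHS](splitr e) lerD ?small //.
apply: le_trans (Lq _) _; apply: le_trans (small _ H).
by rewrite ler_piMl ?nrm_ge0 // ltW.
Qed.

End Topology.
(** * Accretive operators *)

Section Accretive.
Context (R : realType) (V : normedModType R[i]).
Implicit Types (f g : V -> V) (p q : {poly R}).

Definition linop f : Prop :=
  (forall v w, f (v + w) = f v + f w) /\ (forall (a : R[i]) v, f (a *: v) = a *: f v).

Lemma linopD f (lf : linop f) v w : f (v + w) = f v + f w.
Proof. by case: lf. Qed.

Lemma linopZ f (lf : linop f) a v : f (a *: v) = a *: f v.
Proof. by case: lf. Qed.

Lemma linopN f (lf : linop f) v : f (- v) = - f v.
Proof. by rewrite -scaleN1r (linopZ lf) scaleN1r. Qed.

Lemma linopB f (lf : linop f) v w : f (v - w) = f v - f w.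
Proof. by rewrite (linopD lf) (linopN lf). Qed.

Lemma linop0 f (lf : linop f) : f 0 = 0.
Proof. by rewrite -(scale0r 0) (linopZ lf) !scale0r. Qed.

Definition bounded_by f (k : R) : Prop := forall v, nrm (f v) <= k * nrm v.

(** Norm form of accretivity, which makes sense on any normed space; for self-adjoint maps it stands
    for a nonnegative spectrum. *)
Definition accretive f : Prop :=
  forall (s : R) v, 0 < s -> s * nrm v <= nrm (s%:C *: v + f v).

Lemma accretive_ext f g : f =1 g -> accretive f -> accretive g.
Proof. by move=> fg af s v s0; rewrite -fg af. Qed.

Lemma accretiveZ f (c : R) : 0 < c -> accretive f -> accretive (fun v => c%:C *: f v).
Proof.
move=> c0 af s v s0.
have -> : s%:C *: v + c%:C *: f v = c%:C *: ((s / c)%:C *: v + f v) by lmod.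
rewrite nrmZ gtr0_norm //; have := af (s / c) v (divr_gt0 s0 c0).
rewrite -(ler_pM2l c0) => /(le_trans _); apply.
by rewrite mulrA [c * _]mulrC divfK // lt0r_neq0.
Qed.

(* The lower bound is applied at [v - e f v]. *)
Lemma accretive_contraction f (k e : R) v : linop f -> bounded_by f k ->
  accretive f -> 0 <= k -> 0 < e -> nrm (v - e%:C *: f v) <= (1 + (e * k) ^+ 2) * nrm v.
Proof.
move=> lf bf af k0 e0.
have := af e^-1 (v - e%:C *: f v); rewrite invr_gt0 => /(_ e0).
have -> : e^-1%:C *: (v - e%:C *: f v) + f (v - e%:C *: f v) =
   e^-1%:C *: (v - (e ^+ 2)%:C *: f (f v)).
  by rewrite (linopB lf) (linopZ lf); lmod.
rewrite nrmZ gtr0_norm ?invr_gt0 // ler_pM2l ?invr_gt0 // => /le_trans; apply.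
apply: le_trans (nrmB _ _) _; rewrite nrmZ mulrDl mul1r lerD2l.
have -> : (e * k) ^+ 2 * nrm v = e ^+ 2 * (k * (k * nrm v)) by ring.
rewrite ger0_norm ?sqr_ge0 // ler_wpM2l ?sqr_ge0 //.
by apply: le_trans (bf _) _; rewrite ler_wpM2l.
Qed.

(** Up to second order in 1/t, 1 - f/t and 1 - g/t are contractions. Summing them bounds (s + 2t)|v|
    by |s v + f v + g v| + 2t|v| plus an error O(k^2/t), which vanishes as t grows. *)
Lemma accretiveD f g (k : R) : linop f -> linop g -> bounded_by f k ->
  bounded_by g k -> 0 <= k -> accretive f -> accretive g ->
  accretive (fun v => f v + g v).
Proof.
move=> lf lg bf bg k0 af ag s v s0; apply/ler_addgt0Pr => e e0.
have n0 := nrm_ge0 v.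
(* Large enough that the error 2 k^2 |v| / t is at most e. *)
set t := (2 * k ^+ 2 * nrm v + 1) / e.
have t0 : 0 < t by rewrite divr_gt0 ?ltr_wpDl ?mulr_ge0 ?sqr_ge0.
have := accretive_contraction v lf bf af k0 (_ : 0 < t^-1).
have := accretive_contraction v lg bg ag k0 (_ : 0 < t^-1).
rewrite invr_gt0 => /(_ t0) Hg /(_ t0) Hf.
have H1 : (s + 2 * t) * nrm v <= nrm (s%:C *: v + (f v + g v)) +
    t * (nrm (v - t^-1%:C *: f v) + nrm (v - t^-1%:C *: g v)).
  have -> : (s + 2 * t) * nrm v = nrm ((s + 2 * t)%:C *: v).
    by rewrite nrmZ gtr0_norm // addr_gt0 // mulr_gt0.
  have -> : (s + 2 * t)%:C *: v = (s%:C *: v + (f v + g v)) +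
    t%:C *: ((v - t^-1%:C *: f v) + (v - t^-1%:C *: g v)) by lmod.
  apply: le_trans (nrmD _ _) _; rewrite lerD2l nrmZ gtr0_norm // ler_pM2l //.
  exact: nrmD.
have H2 : t * (nrm (v - t^-1%:C *: f v) + nrm (v - t^-1%:C *: g v)) <=
    2 * t * nrm v + 2 * (k ^+ 2 / t) * nrm v.
  apply: le_trans (_ : t * (2 * (1 + (t^-1 * k) ^+ 2) * nrm v) <= _).
    by rewrite ler_pM2l //; lra.
  by rewrite le_eqVlt; apply/orP; left; apply/eqP; field; rewrite lt0r_neq0.
have H3 : 2 * (k ^+ 2 / t) * nrm v <= e.
  have -> : 2 * (k ^+ 2 / t) * nrm v = (2 * k ^+ 2 * nrm v) / t by ring.
  rewrite ler_pdivrMr // /t [e * _]mulrC divfK ?lt0r_neq0 //; lra.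
lra.
Qed.

(** Polynomial calculus p(r); the coefficients are real so that p(r) is self-adjoint whenever r
    is. *)
Definition pact (r : V -> V) p (v : V) : V :=
  \sum_(i < size p) (p`_i)%:C *: iter i r v.

Lemma pact_widen r p v n : (size p <= n)%N ->
  pact r p v = \sum_(i < n) (p`_i)%:C *: iter i r v.
Proof.
move=> pn; rewrite -(subnKC pn) big_split_ord /= [X in _ + X]big1 ?addr0 // => i _.
by rewrite nth_default ?leq_addr // scale0r.
Qed.

Lemma pactD r p q v : pact r (p + q) v = pact r p v + pact r q v.
Proof.
rewrite (@pact_widen r (p + q) v (maxn (size p) (size q))) ?size_polyD //.
rewrite (@pact_widen r p v (maxn (size p) (size q))) ?leq_maxl //.
rewrite (@pact_widen r q v (maxn (size p) (size q))) ?leq_maxr //.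
by rewrite -big_split; apply: eq_bigr => i _; rewrite coefD rmorphD scalerDl.
Qed.

Lemma pactZ r c p v : pact r (c *: p) v = c%:C *: pact r p v.
Proof.
rewrite (@pact_widen r (c *: p) v (size p)) ?size_scale_leq //.
by rewrite scaler_sumr; apply: eq_bigr => i _; rewrite coefZ rmorphM scalerA.
Qed.

Lemma pactN r p v : pact r (- p) v = - pact r p v.
Proof. by rewrite -scaleN1r pactZ rmorphN rmorph1 scaleN1r. Qed.

Lemma pactB r p q v : pact r (p - q) v = pact r p v - pact r q v.
Proof. by rewrite pactD pactN. Qed.

Lemma pactC r c v : pact r c%:P v = c%:C *: v.
Proof.
by rewrite (@pact_widen r c%:P v 1) ?size_polyC_leq1 // big_ord1 coefC.
Qed.

Lemma pact0 r v : pact r 0 v = 0.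
Proof. by rewrite /pact size_poly0 big_ord0. Qed.

Lemma pact1 r v : pact r 1 v = v.
Proof. by rewrite pactC scale1r. Qed.

Lemma linop_sum f (I : finType) (F : I -> V) : linop f ->
  f (\sum_i F i) = \sum_i f (F i).
Proof.
by move=> lf; apply: (big_morph f); [exact: linopD | exact: linop0].
Qed.

Lemma pactMX r p v : linop r -> pact r (p * 'X) v = r (pact r p v).
Proof.
move=> lr; rewrite (@pact_widen r (p * 'X) v (size p).+1).
  rewrite big_ord_recl coefMX eqxx scale0r add0r (linop_sum _ lr).
  by apply: eq_bigr => i _; rewrite coefMX /= (linopZ lr).
by rewrite (leq_trans (size_polyMleq _ _)) // size_polyX addn2.
Qed.

Lemma pactX r v : linop r -> pact r 'X v = r v.
Proof. by move=> lr; rewrite -['X]mul1r pactMX // pact1. Qed.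

Lemma pactM r p q v : linop r -> pact r (p * q) v = pact r p (pact r q v).
Proof.
move=> lr; elim/poly_ind: p => [|p c IH].
  by rewrite mul0r !pact0.
rewrite mulrDl mulrAC pactD pactMX // IH pactD pactMX // pactC.
by rewrite mul_polyC pactZ.
Qed.

Lemma linop_pact r p : linop r -> linop (pact r p).
Proof.
move=> lr; split=> [v w|a v]; rewrite /pact.
  rewrite -big_split; apply: eq_bigr => i _ /=; rewrite -scalerDr; congr (_ *: _).
  by elim: (i : nat) => //= n ->; rewrite (linopD lr).
rewrite scaler_sumr; apply: eq_bigr => i _; rewrite !scalerA mulrC -scalerA.
by congr (_ *: _); elim: (i : nat) => //= n ->; rewrite (linopZ lr).
Qed.

Lemma pact_exp_bounded r p (b : R) n : linop r -> 0 <= b ->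
  bounded_by (pact r p) b -> bounded_by (pact r (p ^+ n)) (b ^+ n).
Proof.
move=> lr b0 H v; elim: n => [|n IH]; first by rewrite !expr0 pact1 mul1r.
rewrite !exprS pactM //; apply: le_trans (H _) _.
by rewrite -mulrA ler_wpM2l.
Qed.

Lemma pact_bounded r p (b : R) : bounded_by r b -> 0 <= b ->
  exists2 k : R, 0 <= k & bounded_by (pact r p) k.
Proof.
move=> br b0; exists (\sum_(i < size p) `|p`_i| * b ^+ i).
  by rewrite sumr_ge0 // => i _; rewrite mulr_ge0 ?exprn_ge0.
move=> v; rewrite /pact mulr_suml.
elim/big_rec2: _ => [|i y z _ H]; first by rewrite nrm0.
apply: le_trans (nrmD _ _) _; apply: lerD => //.
rewrite nrmZ -mulrA ler_wpM2l //; elim: (i : nat) => /= [|n IH]; first by rewrite mul1r.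
by apply: le_trans (br _) _; rewrite exprS -mulrA ler_wpM2l.
Qed.

End Accretive.

(** * Positivity in C*-algebras *)

Section CStar.
Context (R : realType) (B : cstarAlgType R).
Implicit Types (x y z v w : B) (f g h : B -> B) (p q : {poly R}).

Local Notation "x ** y" := (cmul x y) (at level 40, left associativity).

Lemma cstarZc (a : R[i]) x : cstar (a *: x) = conjc a *: cstar x.
Proof. exact: cstarZ. Qed.

Lemma cstar0 : cstar (0 : B) = 0.
Proof. by have := cstarZc 0 (0 : B); rewrite conjc0 !scale0r. Qed.

Lemma cstarN x : cstar (- x) = - cstar x.
Proof. by rewrite -scaleN1r cstarZc rmorphN rmorph1 scaleN1r. Qed.

Lemma cmulNl x y : - x ** y = - (x ** y).
Proof. by rewrite -scaleN1r cscaleAl scaleN1r. Qed.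

Lemma cmulNr x y : x ** - y = - (x ** y).
Proof. by rewrite -scaleN1r cscaleAr scaleN1r. Qed.

Lemma cmul0l x : 0 ** x = 0.
Proof. by have := cscaleAl 0 (0 : B) x; rewrite !scale0r. Qed.

Lemma cmul0r x : x ** 0 = 0.
Proof. by have := cscaleAr 0 x (0 : B); rewrite !scale0r. Qed.

Definition cmulE := (@cmulDl R B, @cmulDr R B, cmulNl, cmulNr, @cscaleAl R B, @cscaleAr R B).
Definition cstarE := (@cstarD R B, cstarN, cstarZc, @cstarM R B, @cstarK R B).

Lemma nrmM x y : nrm (x ** y) <= nrm x * nrm y.
Proof. by rewrite -lecR rmorphM /= -!nrmE normr_cmul. Qed.

Lemma nrm_cstar_id x : nrm (cstar x ** x) = nrm x ^+ 2.
Proof. by apply: complexI; rewrite rmorphXn /= -!nrmE cstar_identity. Qed.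

Lemma nrm_cstar x : nrm (cstar x) = nrm x.
Proof.
have half y : nrm y <= nrm (cstar y).
  have := nrmM (cstar y) y; rewrite nrm_cstar_id expr2.
  have := nrm_ge0 y; rewrite le_eqVlt => /orP[/eqP <- _|y0]; first exact: nrm_ge0.
  by rewrite ler_pM2r.
by apply/le_anti; have := half (cstar x); rewrite cstarK half => ->.
Qed.

(** Adjointness for the inner product v^* w that makes B a module over itself. Maps on B replace
    elements, since B may lack a unit and 1 + x^* x need not lie in it. *)
Definition adjoint_pair f g : Prop := forall v w, cstar (f v) ** w = cstar v ** g w.

Lemma adjoint_pairC f g : adjoint_pair f g -> adjoint_pair g f.
Proof.
move=> H v w; apply: (can_inj (@cstarK _ _)); rewrite !cstarM !cstarK.
by rewrite H.
Qed.

Lemma linop_cmul x : linop (cmul x).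
Proof. by split=> [v w|a v]; rewrite cmulE. Qed.

Lemma linop_comp f g : linop f -> linop g -> linop (f \o g).
Proof.
by move=> lf lg; split=> [v w|a v] /=;
  rewrite ?(linopD lg) ?(linopD lf) ?(linopZ lg) ?(linopZ lf).
Qed.

Lemma adjoint_cmul x : adjoint_pair (cmul x) (cmul (cstar x)).
Proof. by move=> v w; rewrite cstarM cmulA. Qed.

Lemma adjoint_comp f f' g g' : adjoint_pair f f' -> adjoint_pair g g' ->
  adjoint_pair (f \o g) (g' \o f').
Proof. by move=> Hf Hg v w; rewrite /= Hf Hg. Qed.

Lemma adjoint_pact f p : adjoint_pair f f -> linop f ->
  adjoint_pair (pact f p) (pact f p).
Proof.
move=> af lf v w; elim/poly_ind: p v w => [|p c IH] v w.
  by rewrite !pact0 cstar0 cmul0l cmul0r.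
have fp u : f (pact f p u) = pact f p (f u).
  by rewrite -(pactMX p u lf) pactM // pactX.
rewrite !pactD !pactMX // !pactC !cstarE !cmulE {1}fp IH af.
by rewrite conjc_real.
Qed.

(** For either sign the cross terms of the inner square cancel by self-adjointness, leaving s^2 v^*
    v + (h v)^* (h v). *)
Lemma selfadjoint_isometry h (s : R) v : adjoint_pair h h ->
  nrm (s%:C *: v + 'i *: h v) = nrm (s%:C *: v - 'i *: h v).
Proof.
move=> ah; apply: (@pexpIrn _ 2) => //; rewrite ?nnegrE ?nrm_ge0 //.
rewrite -!nrm_cstar_id; congr nrm.
rewrite !cstarE !cmulE (ah v v); lmod.
Qed.

(** With s = t^2 one has t^2 + h^2 = (t + i h)(t - i h), and by the isometry each factor is bounded
    below by t. *)
Lemma accretive_square h : linop h -> adjoint_pair h h -> accretive (h \o h).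
Proof.
move=> lh ah s v s0.
have [t t0 ->] : exists2 t : R, 0 < t & s = t ^+ 2.
  by exists (Num.sqrt s); rewrite ?sqrtr_gt0 // sqr_sqrtr // ltW.
have iso w : t * nrm w <= nrm (t%:C *: w + 'i *: h w).
  have : nrm ((2 * t)%:C *: w) <= 2 * nrm (t%:C *: w + 'i *: h w).
    have -> : (2 * t)%:C *: w = (t%:C *: w + 'i *: h w) + (t%:C *: w - 'i *: h w) by lmod.
    by apply: le_trans (nrmD _ _) _; rewrite -selfadjoint_isometry //; lra.
  by rewrite nrmZ gtr0_norm ?mulr_gt0 //; lra.
have -> : (t ^+ 2)%:C *: v + (h \o h) v =
    t%:C *: (t%:C *: v - 'i *: h v) + 'i *: h (t%:C *: v - 'i *: h v).
  by rewrite (linopB lh) !(linopZ lh) /=; lmod.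
apply: le_trans (iso _); rewrite expr2 -mulrA ler_pM2l //.
by rewrite -selfadjoint_isometry.
Qed.

(* [g f + f g] is half the sum of the squares of [f + g] and [i (f - g)]. *)
Lemma accretive_adjoint_pair f g (k : R) : linop f -> linop g ->
  bounded_by f k -> bounded_by g k -> 0 <= k -> adjoint_pair f g ->
  accretive (fun v => g (f v) + f (g v)).
Proof.
move=> lf lg bf bg k0 fg; have gf := adjoint_pairC fg.
pose u v := f v + g v; pose w v := 'i *: (f v - g v).
have lu : linop u.
  by split=> [a b|a b]; rewrite /u !(linopD lf, linopD lg, linopZ lf, linopZ lg); lmod.
have lw : linop w.
  split=> [a b|a b]; rewrite /w !(linopD lf, linopD lg, linopZ lf, linopZ lg); lmod.
have au : adjoint_pair u u by move=> a b; rewrite /u !cstarE !cmulE fg gf addrC.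
have aw : adjoint_pair w w.
  by move=> a b; rewrite /w !cstarE !cmulE fg gf; lmod.
have bu : bounded_by (u \o u) ((k + k) * (k + k)).
  have H a : nrm (u a) <= (k + k) * nrm a.
    by apply: le_trans (nrmD _ _) _; rewrite mulrDl lerD.
  by move=> a; apply: le_trans (H _) _; rewrite -mulrA ler_wpM2l ?addr_ge0.
have bw : bounded_by (w \o w) ((k + k) * (k + k)).
  have H a : nrm (w a) <= (k + k) * nrm a.
    by rewrite nrmiZ; apply: le_trans (nrmB _ _) _; rewrite mulrDl lerD.
  by move=> a; apply: le_trans (H _) _; rewrite -mulrA ler_wpM2l ?addr_ge0.
have := accretiveD (linop_comp lu lu) (linop_comp lw lw) bu bw
  (mulr_ge0 (addr_ge0 k0 k0) (addr_ge0 k0 k0)) (accretive_square lu au) (accretive_square lw aw).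
move/(accretiveZ (_ : 0 < 2^-1)); rewrite invr_gt0 => /(_ (ltr0Sn _ _)).
apply: accretive_ext => v; rewrite /= /u /w.
rewrite !(linopZ lf, linopZ lg, linopD lf, linopD lg, linopN lf, linopN lg).
lmod.
Qed.

End CStar.

(** * Norm bounds from two-sided accretivity bounds *)

Section NormBound.
Context (R : realType) (B : cstarAlgType R).
Implicit Types (f h : B -> B) (p q : {poly R}).

Let power8_identity : ('X + 1) ^+ 8 - (1 - 'X) ^+ 8 =
  16%:R *: ((1 + 'X ^+ 2) * ((1 + (6%:R *: 'X ^+ 2 + 'X ^+ 4)) * 'X)) :> {poly R}.
Proof. by rewrite -!mul_polyC rmorph_nat; ring. Qed.

(** Three successive squarings, each rounded up to a short decimal. *)
Let pow8_bound (b : R) : 0 <= b -> b <= 1055 / 1000 -> b ^+ 8 <= 1536 / 1000.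
Proof.
move=> b0 bE.
have sq (x c d : R) : 0 <= x -> x <= c -> c ^+ 2 <= d -> x ^+ 2 <= d.
  by move=> x0 xc; apply: le_trans; rewrite ler_pXn2r ?nnegrE ?(le_trans x0).
have -> : b ^+ 8 = ((b ^+ 2) ^+ 2) ^+ 2 by rewrite -!exprM.
apply: (sq _ (12391 / 10000)); [exact: sqr_ge0 | | lra].
apply: (sq _ (11131 / 10000)); [exact: sqr_ge0 | | lra].
by apply: (sq _ (1055 / 1000)); [ | | lra].
Qed.

(* With [z = f / (5 k)] one has
   [(1 + z)^8 - (1 - z)^8 = 16 z (1 + z^2) (1 + 6 z^2 + z^4)], where the two last
   factors are bounded below by 1, while accretivity bounds [1 + z] and [1 - z]. *)
Lemma selfadjoint_bound_step f (s k : R) : linop f -> adjoint_pair f f -> 0 < s ->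
  accretive (fun v => s%:C *: v + f v) -> accretive (fun v => s%:C *: v - f v) ->
  20 * s <= k -> bounded_by f k -> bounded_by f (97 / 100 * k).
Proof.
move=> lf af s0 ap am sk bf v; have k0 : 0 < k by lra.
pose r := (5 * k)^-1; have r0 : 0 < r by rewrite invr_gt0 mulr_gt0.
pose z u := r%:C *: f u.
have lz : linop z by split=> [a b|c a]; rewrite /z ?(linopD lf) ?(linopZ lf); lmod.
have az : adjoint_pair z z.
  by move=> a b; rewrite /z !cstarE !cmulE conjc_real af.
have bz : bounded_by z (1 / 5).
  move=> u; rewrite /z nrmZ gtr0_norm //; apply: le_trans (_ : r * (k * nrm u) <= _).
    by rewrite ler_pM2l.
  by rewrite /r le_eqVlt; apply/orP; left; apply/eqP; field; rewrite lt0r_neq0.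
(* The value exceeds 1 + (21/100)^2 + 1/100, where r (s + k) <= 21/100 and r s <= 1/100. Naming it
   keeps its powers symbolic. *)
have [b [b0 bE]] : exists b : R, 0 <= b /\ b = 1055 / 1000.
  exists (1055 / 1000); split; [lra | reflexivity].
have half (g : B -> B) : linop g -> bounded_by g k -> accretive (fun u => s%:C *: u + g u) ->
    bounded_by (fun u => u - r%:C *: g u) b.
  move=> lg bg ag u.
  have lsg : linop (fun u => s%:C *: u + g u).
    by split=> [x y|c x]; rewrite ?(linopD lg) ?(linopZ lg); lmod.
  have bsg : bounded_by (fun u => s%:C *: u + g u) (s + k).
    move=> x; apply: le_trans (nrmD _ _) _; rewrite nrmZ gtr0_norm // mulrDl lerD2l.
    exact: bg.
  have H := accretive_contraction u lsg bsg ag (ltac:(lra) : 0 <= s + k) r0.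
  have -> : u - r%:C *: g u = (u - r%:C *: (s%:C *: u + g u)) + (r * s)%:C *: u by lmod.
  apply: le_trans (nrmD _ _) _; rewrite nrmZ gtr0_norm ?mulr_gt0 //.
  have rs : r * s <= 1 / 100.
    by rewrite /r mulrC ler_pdivrMr ?mulr_gt0 //; lra.
  have rk : r * k = 1 / 5 by rewrite /r; field; rewrite lt0r_neq0.
  have : (r * (s + k)) ^+ 2 <= (21 / 100) ^+ 2.
    have rs0 : 0 < r * s by rewrite mulr_gt0.
    by rewrite ler_pXn2r ?nnegrE //; nra.
  by have := nrm_ge0 u; rewrite bE; nra.
have bp : bounded_by (pact z ('X + 1)) b.
  move=> u; rewrite pactD pactX // pact1.
  have lnf : linop (fun x => - f x).
    by split=> [x y|c x]; rewrite ?(linopD lf) ?(linopZ lf); lmod.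
  have bnf : bounded_by (fun x => - f x) k by move=> x; rewrite nrmN.
  by have := half _ lnf bnf am u; congr (nrm _ <= _); rewrite /z; lmod.
have bm : bounded_by (pact z (1 - 'X)) b.
  by move=> u; rewrite pactB pactX // pact1; exact: half lf bf ap u.
have azz q : accretive (pact z (q ^+ 2)).
  have := accretive_square (linop_pact q lz) (adjoint_pact q az lz).
  by apply: accretive_ext => u /=; rewrite expr2 pactM.
have lower q u : accretive (pact z q) -> nrm u <= nrm (pact z (1 + q) u).
  by move=> aq; have := aq 1 u ltr01; rewrite mul1r pactD pact1 scale1r.
have [k1 k10 bk1] := pact_bounded ('X ^+ 2) bz (ltac:(lra) : (0 : R) <= 1 / 5).
have [k2 k20 bk2] := pact_bounded ('X ^+ 4) bz (ltac:(lra) : (0 : R) <= 1 / 5).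
have a64 : accretive (pact z (6%:R *: 'X ^+ 2 + 'X ^+ 4)).
  have b64 : bounded_by (fun u => 6%:R%:C *: pact z ('X ^+ 2) u) (6 * k1 + k2).
    move=> u; rewrite nrmZ ger0_norm //; have := bk1 u; have := nrm_ge0 u; nra.
  have b4 : bounded_by (pact z ('X ^+ 4)) (6 * k1 + k2).
    by move=> u; apply: le_trans (bk2 u) _; rewrite ler_wpM2r ?nrm_ge0 //; lra.
  have l6 : linop (fun u => 6%:R%:C *: pact z ('X ^+ 2) u).
    have l2 := linop_pact ('X ^+ 2) lz.
    by split=> [x y|c x]; rewrite ?(linopD l2) ?(linopZ l2); lmod.
  have a4 : accretive (pact z ('X ^+ 4)) by have := azz ('X ^+ 2); rewrite -exprM.
  have := accretiveD l6 (linop_pact ('X ^+ 4) lz) b64 b4 (ltac:(lra))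
    (accretiveZ (ltr0Sn _ 5) (azz 'X)) a4.
  by apply: accretive_ext => u; rewrite pactD pactZ.
have H : 16 * nrm (z v) <= 2 * b ^+ 8 * nrm v.
  have E : pact z (('X + 1) ^+ 8 - (1 - 'X) ^+ 8) v = 16%:R%:C *:
      pact z (1 + 'X ^+ 2) (pact z (1 + (6%:R *: 'X ^+ 2 + 'X ^+ 4)) (z v)).
    by rewrite power8_identity pactZ pactM // [in LHS]pactM // pactX.
  apply: le_trans (_ : nrm (pact z (('X + 1) ^+ 8 - (1 - 'X) ^+ 8) v) <= _).
    rewrite E [leRHS]nrmZ ger0_norm // ler_pM2l //.
    by apply: le_trans (lower _ _ a64) (lower _ _ (azz 'X)).
  rewrite pactB; apply: le_trans (nrmB _ _) _.
  have := pact_exp_bounded 8 lz b0 bp v; have := pact_exp_bounded 8 lz b0 bm v.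
  lra.
have ble : b <= 1055 / 1000 by lra.
have b8 := pow8_bound b0 ble.
have zE : nrm (z v) = r * nrm (f v) by rewrite nrmZ gtr0_norm.
have fE : nrm (f v) = 5 * k * nrm (z v).
  by rewrite zE /r; field; rewrite lt0r_neq0.
have n0 := nrm_ge0 v.
(* Here 16 |z v| <= 2 * 1.536 |v|, and the factor 97/100 of the conclusion is 5 * 194/1000. *)
have : nrm (z v) <= 194 / 1000 * nrm v by nra.
by rewrite fE; nra.
Qed.

(** Under -s <= f <= s, each step multiplies the bound by 97/100, until it falls to 20 s, the
    threshold at which the step stops applying. *)
Lemma selfadjoint_bound f (s k : R) : linop f -> adjoint_pair f f -> 0 < s ->
  accretive (fun v => s%:C *: v + f v) -> accretive (fun v => s%:C *: v - f v) ->
  bounded_by f k -> bounded_by f (20 * s).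
Proof.
move=> lf af s0 ap am bf v; rewrite leNgt; apply/negP => Hv.
have n0 : 0 < nrm v.
  rewrite lt_neqAle nrm_ge0 andbT; apply/eqP => v0; move: Hv.
  by rewrite -v0 (nrm0_eq0 (esym v0)) (linop0 lf) nrm0 mulr0 ltxx.
have iter_bound n : bounded_by f (Num.max (20 * s) ((97 / 100) ^+ n * k)).
  elim: n => [|n IH] u.
    apply: le_trans (bf u) _; rewrite mul1r ler_wpM2r ?nrm_ge0 //.
    by rewrite le_max lexx orbT.
  have [le20|/ltW ge20] := lerP (20 * s) ((97 / 100) ^+ n * k).
    rewrite (max_idPr le20) in IH.
    apply: le_trans (selfadjoint_bound_step lf af s0 ap am le20 IH u) _.
    by rewrite ler_wpM2r ?nrm_ge0 // exprS le_max mulrA lexx orbT.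
  rewrite (max_idPl ge20) in IH; apply: le_trans (IH u) _.
  by rewrite ler_wpM2r ?nrm_ge0 // le_max lexx.
have [|n0' /(_ n0' (leqnn _)) Hn] := @expr_small R (97 / 100) (20 * s / (`|k| + 1)) ltac:(lra) ltac:(lra).
  by rewrite divr_gt0 ?mulr_gt0 // ltr_wpDl.
have := iter_bound n0' v; rewrite leNgt => /negP; apply.
apply: le_lt_trans Hv; rewrite ler_pM2r //.
rewrite ge_max lexx /=; rewrite ltr_pdivlMr ?ltr_wpDl // in Hn.
have p0 : 0 < (97 / 100 : R) ^+ n0' by apply: exprn_gt0; lra.
apply: le_trans (ltW Hn); rewrite ler_pM2l //.
by have := ler_norm k; lra.
Qed.

End NormBound.

(** * Kaplansky's theorem and monotonicity of the norm *)

Section Kaplansky.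
Context (R : realType) (B : cstarAlgType R).
Implicit Types (x z v w : B) (f g h L : B -> B) (p q : {poly R}).

Local Notation "x ** y" := (cmul x y) (at level 40, left associativity).

(** [r] is (1 + L)^-1. The Neumann series gives existence; |v| <= 2 |v + L v| gives injectivity, and
    with it linearity. *)
Lemma neumann_inverse L : linop L -> adjoint_pair L L -> bounded_by L (1 / 2) ->
  exists r : B -> B, [/\ linop r, adjoint_pair r r, bounded_by r 2,
    forall v, r v + L (r v) = v & forall v, r (v + L v) = v].
Proof.
move=> lL aL bL.
have [r Hr] : exists r : B -> B, forall v, r v + L (r v) = v.
  have H v : exists w, w + L w = v.
    by apply: (@neumann R B L (1 / 2)); [lra | lra | exact: linopB | exact: bL].
  by exists (fun v => projT1 (cid (H v))) => v; case: cid.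
have low v : nrm v <= 2 * nrm (v + L v).
  have := nrmB (v + L v) (L v); rewrite addrK; have := bL v; lra.
have inj v w : v + L v = w + L w -> v = w.
  move=> E; apply/eqP; rewrite -subr_eq0; apply/eqP/nrm0_eq0/le_anti.
  rewrite nrm_ge0 andbT; apply: le_trans (low _) _.
  have -> : v - w + L (v - w) = (v + L v) - (w + L w) by rewrite (linopB lL); lmod.
  by rewrite E subrr nrm0 mulr0.
have Hl v : r (v + L v) = v by apply: inj; rewrite Hr.
exists r; split=> //.
- split=> [v w|c v]; apply: inj; rewrite Hr.
    by rewrite (linopD lL) addrACA !Hr.
  by rewrite (linopZ lL) -scalerDr Hr.
- move=> v w; rewrite -{2}(Hr v) -{1}(Hr w) !cstarE !cmulE.
  by rewrite (aL (r v) (r w)).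
- by move=> v; rewrite -{2}(Hr v) low.
Qed.

Lemma pact_iter f n v : linop f -> pact f 'X^n v = iter n f v.
Proof.
by move=> lf; elim: n => [|n IH] /=; rewrite ?expr0 ?pact1 // exprSr pactMX // IH.
Qed.

Lemma accretive_shift f (s : R) : 0 <= s -> accretive f ->
  accretive (fun v => s%:C *: v + f v).
Proof.
move=> s0 af t v t0.
have -> : t%:C *: v + (s%:C *: v + f v) = (t + s)%:C *: v + f v by lmod.
have := af (t + s) v (ltr_wpDr s0 t0); apply: le_trans.
by rewrite ler_wpM2r ?nrm_ge0 // lerDl.
Qed.

(** * Uniform bounds on the powers of (1 + x^* x)^-1 *)

Section PowerBound.
Context (x : B) (r r' : B -> B).
Hypotheses (lr : linop r) (lr' : linop r') (ar : adjoint_pair r r)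
  (ar' : adjoint_pair r' r') (br : bounded_by r 2) (br' : bounded_by r' 2)
  (Hr : forall v, r v + cstar x ** (x ** r v) = v)
  (Hr' : forall v, r' (v + x ** (cstar x ** v)) = v).

(** The two resolvents are kept together because at this stage only a sum y^* y + y y^* is known to
    be accretive. *)
Let Phi p v := pact r p v + pact r' p v.

(** This follows from x (1 + x^* x) = (x x^* + 1) x. *)
Let intertwine p v : x ** pact r p v = pact r' p (x ** v).
Proof.
elim/poly_ind: p v => [|p c IH] v; first by rewrite !pact0 cmul0r.
rewrite !pactD !pactMX // !pactC cmulDr cscaleAr; congr (_ + _).
rewrite -IH; set w := pact r p v.
by rewrite -[in RHS](Hr w) cmulDr Hr'.
Qed.

Let linop_Phi p : linop (Phi p).
Proof.
have l := linop_pact p lr; have l' := linop_pact p lr'.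
by split=> [v w|c v]; rewrite /Phi ?(linopD l) ?(linopD l') ?(linopZ l) ?(linopZ l'); lmod.
Qed.

Let Phi_bounded p : exists2 k : R, 0 <= k & bounded_by (Phi p) k.
Proof.
have [k k0 bk] := pact_bounded p br (ler0n _ 2).
have [k' k'0 bk'] := pact_bounded p br' (ler0n _ 2).
exists (k + k'); first exact: addr_ge0.
by move=> v; apply: le_trans (nrmD _ _) _; rewrite mulrDl lerD.
Qed.

Let accretive_PhiD p q : accretive (Phi p) -> accretive (Phi q) -> accretive (Phi (p + q)).
Proof.
move=> ap aq; have [k k0 bk] := Phi_bounded p; have [k' k'0 bk'] := Phi_bounded q.
have b1 : bounded_by (Phi p) (k + k').
  by move=> v; apply: le_trans (bk v) _; rewrite ler_wpM2r ?nrm_ge0 // lerDl.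
have b2 : bounded_by (Phi q) (k + k').
  by move=> v; apply: le_trans (bk' v) _; rewrite ler_wpM2r ?nrm_ge0 // lerDr.
have := accretiveD (linop_Phi p) (linop_Phi q) b1 b2 (addr_ge0 k0 k'0) ap aq.
by apply: accretive_ext => v; rewrite /Phi !pactD addrACA.
Qed.

(* [y = x q(r) r] has [y^* y = (r - r^2) q(r)^2], and [y y^*] is the same
   expression in [r']. *)
Let accretive_Phi_base q : accretive (Phi ('X * (1 - 'X) * q ^+ 2)).
Proof.
have lq := linop_pact (q * 'X) lr.
have aq := adjoint_pact (q * 'X) ar lr.
have lf : linop (cmul x \o pact r (q * 'X)) := linop_comp (linop_cmul x) lq.
have lg : linop (pact r (q * 'X) \o cmul (cstar x)) := linop_comp lq (linop_cmul _).
have [k k0 bk] := pact_bounded (q * 'X) br (ler0n _ 2).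
have bf : bounded_by (cmul x \o pact r (q * 'X)) (nrm x * k).
  by move=> v; apply: le_trans (nrmM _ _) _; rewrite -mulrA ler_wpM2l ?nrm_ge0.
have bg : bounded_by (pact r (q * 'X) \o cmul (cstar x)) (nrm x * k).
  move=> v; apply: le_trans (bk _) _; rewrite [nrm x * k]mulrC -mulrA ler_wpM2l //.
  by apply: le_trans (nrmM _ _) _; rewrite nrm_cstar.
have := accretive_adjoint_pair lf lg bf bg (mulr_ge0 (nrm_ge0 x) k0)
  (adjoint_comp (adjoint_cmul x) aq).
apply: accretive_ext => v; rewrite /= /Phi; congr (_ + _).
  have -> : cstar x ** (x ** pact r (q * 'X) v) = pact r (q * (1 - 'X)) v.
    rewrite pactMX // mulrBr mulr1 pactB pactMX //.
    by apply: (addrI (r (pact r q v))); rewrite Hr addrC subrK.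
  by rewrite -pactM //; congr pact; ring.
rewrite -pactM // intertwine.
have -> : q * 'X * (q * 'X) = q ^+ 2 * 'X * 'X by ring.
rewrite pactM // pactX //.
have -> : r' (x ** (cstar x ** v)) = pact r' (1 - 'X) v.
  rewrite pactB pact1 pactX //; apply: (addrI (r' v)).
  by rewrite -(linopD lr') Hr' addrC subrK.
by rewrite -pactM //; congr pact; ring.
Qed.

(** A telescoping family: U k - U (k + 1) = X (1 - X) (X^k (1 + X))^2 has the form treated in
    [accretive_Phi_base]. *)
Let U k : {poly R} := 'X * (1 + 'X) * ('X ^+ k) ^+ 2.

Let accretive_PhiU m j : accretive (Phi (U m - U (m + j)%N)).
Proof.
elim: j => [|j IH].
  rewrite addn0 subrr => s v s0.
  by rewrite /Phi !pact0 !addr0 nrmZ gtr0_norm.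
have -> : U m - U (m + j.+1)%N = (U m - U (m + j)%N) +
    'X * (1 - 'X) * ('X ^+ (m + j) * (1 + 'X)) ^+ 2.
  by rewrite addnS /U (exprS 'X (m + j)); ring.
exact: accretive_PhiD.
Qed.

(** With Z = X^m, the terms U m - U (2m), X (1 - X) Z^2 and X (1 - X) Z^4 add up to 2 (X Z^2 - X^2
    Z^4), where X Z^2 is the odd power X^(2m+1). *)
Let accretive_Phi_power m : accretive (Phi ('X * ('X ^+ m) ^+ 2 - ('X * ('X ^+ m) ^+ 2) ^+ 2)).
Proof.
have := accretive_PhiD (accretive_PhiU m m) (accretive_PhiD
  (accretive_Phi_base ('X ^+ m)) (accretive_Phi_base ('X ^+ m * 'X ^+ m))).
move/(accretiveZ (_ : 0 < 2^-1)); rewrite invr_gt0 => /(_ (ltr0Sn _ _)).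
apply: accretive_ext => v; rewrite /Phi /U exprD.
set Z := 'X ^+ m.
have -> : 'X * (1 + 'X) * Z ^+ 2 - 'X * (1 + 'X) * (Z * Z) ^+ 2 +
   ('X * (1 - 'X) * Z ^+ 2 + 'X * (1 - 'X) * (Z * Z) ^+ 2) =
   2%:R *: ('X * Z ^+ 2 - ('X * Z ^+ 2) ^+ 2).
  by rewrite -mul_polyC rmorph_nat; ring.
by rewrite !pactZ; lmod.
Qed.

(** Let N = 2m + 1. Adding (r'^N - 1/2)^2 to the accretive sum in [r] and [r'] eliminates [r'] and
    leaves 1/4 + r^N - r^(2N) = 1/2 - (r^N - 1/2)^2. So [selfadjoint_bound] with s = 1/2 bounds (r^N
    - 1/2)^2 by 10, hence r^N - 1/2 by 4. *)
Let power_bounded m v : nrm (iter m.*2.+1 r v) <= 5 * nrm v.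
Proof.
set XN : {poly R} := 'X * ('X ^+ m) ^+ 2.
have EN : XN = 'X^(m.*2.+1) by rewrite /XN -exprM muln2 -exprS.
rewrite -pact_iter // -EN {EN}.
set h := (2^-1)%:P : {poly R}.
have lsq := linop_pact ((XN - h) ^+ 2) lr.
have asq := adjoint_pact ((XN - h) ^+ 2) ar lr.
have [k k0 bsq] := pact_bounded ((XN - h) ^+ 2) br (ler0n _ 2).
have sq (f : B -> B) q : linop f -> adjoint_pair f f -> accretive (pact f (q ^+ 2)).
  move=> lf af; have := accretive_square (linop_pact q lf) (adjoint_pact q af lf).
  by apply: accretive_ext => u /=; rewrite expr2 pactM.
have s0 : 0 < 2^-1 :> R by rewrite invr_gt0.
have ap := accretive_shift (ltW s0) (sq r (XN - h) lr ar).
have am : accretive (fun v => 2^-1%:C *: v - pact r ((XN - h) ^+ 2) v).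
  have l' := linop_pact ((XN - h) ^+ 2) lr'.
  have [k1 k10 b1] := Phi_bounded (XN - XN ^+ 2).
  have [k2 k20 b2] := pact_bounded ((XN - h) ^+ 2) br' (ler0n _ 2).
  have b1' : bounded_by (Phi (XN - XN ^+ 2)) (k1 + k2).
    by move=> u; apply: le_trans (b1 u) _; rewrite ler_wpM2r ?nrm_ge0 // lerDl.
  have b2' : bounded_by (pact r' ((XN - h) ^+ 2)) (k1 + k2).
    by move=> u; apply: le_trans (b2 u) _; rewrite ler_wpM2r ?nrm_ge0 // lerDr.
  have := accretiveD (linop_Phi _) l' b1' b2' (addr_ge0 k10 k20)
    (accretive_Phi_power m) (sq r' (XN - h) lr' ar').
  apply: accretive_ext => u; rewrite /Phi -/XN.
  have -> : (XN - h) ^+ 2 = h ^+ 2 - (XN - XN ^+ 2).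
    have -> : (XN - h) ^+ 2 = XN ^+ 2 - (h + h) * XN + h ^+ 2 by ring.
    by rewrite -polyCD -div1r -splitr; ring.
  rewrite !(pactB _ (h ^+ 2)) -!polyC_exp !pactC.
  by lmod.
have Hb := selfadjoint_bound lsq asq s0 ap am bsq v.
have H : nrm (pact r (XN - h) v) <= 4 * nrm v.
  have n0 := nrm_ge0 v; have m0 := nrm_ge0 (pact r (XN - h) v).
  have H : nrm (pact r (XN - h) v) ^+ 2 <= 10 * nrm v ^+ 2.
    rewrite -nrm_cstar_id (adjoint_pact (XN - h) ar lr) -pactM // -expr2.
    apply: le_trans (nrmM _ _) _; rewrite nrm_cstar.
    by apply: le_trans (ler_wpM2l n0 Hb) _; lra.
  by rewrite leNgt; apply/negP => Hlt; nra.
have -> : pact r XN v = pact r (XN - h) v + 2^-1%:C *: v.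
  by rewrite pactB pactC subrK.
apply: le_trans (nrmD _ _) _; rewrite nrmZ gtr0_norm //.
have := nrm_ge0 v; lra.
Qed.

(* [nrm (r^j v)] is logarithmically convex in [j]. *)
Lemma resolvent_contraction v : nrm (r v) <= nrm v.
Proof.
rewrite leNgt; apply/negP => Hv.
have n0 : 0 < nrm v.
  rewrite lt_neqAle nrm_ge0 andbT; apply/eqP => v0; move: Hv.
  by rewrite -v0 (nrm0_eq0 (esym v0)) (linop0 lr) nrm0 ltxx.
set rho := nrm (r v) / nrm v.
have rho1 : 1 < rho by rewrite ltr_pdivlMr // mul1r.
have rho0 : 0 < rho by lra.
have conv w : nrm (r w) ^+ 2 <= nrm w * nrm (r (r w)).
  rewrite -nrm_cstar_id (ar w (r w)); apply: le_trans (nrmM _ _) _.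
  by rewrite nrm_cstar.
(* Log-convexity propagates the first growth ratio [rho] > 1 to all iterates, which therefore grow
   geometrically. *)
have grow j : 0 < nrm (iter j r v) /\ rho * nrm (iter j r v) <= nrm (iter j.+1 r v).
  elim: j => [|j [c0 IH]] /=; first by rewrite /rho divfK // lt0r_neq0.
  have c1 : 0 < nrm (iter j.+1 r v) by apply: lt_le_trans IH; rewrite mulr_gt0.
  split=> //; have := conv (iter j r v); rewrite expr2 => /= H.
  rewrite -(ler_pM2l c0); apply: le_trans H; rewrite mulrCA mulrA.
  by rewrite ler_pM2r.
have pow j : rho ^+ j * nrm v <= nrm (iter j r v).
  elim: j => [|j IH]; first by rewrite mul1r.
  have [_] := grow j; apply: le_trans; rewrite exprS -mulrA ler_pM2l //.
have i0 : 0 <= rho^-1 by rewrite invr_ge0 ltW.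
have i1 : rho^-1 < 1 by rewrite invf_lt1.
(* The exponent 2n + 1 is odd, as in [power_bounded]; [rho] to this power exceeds 5, a
   contradiction. *)
have [n H] := expr_small i0 i1 (ltac:(lra) : 0 < 1 / 5).
have := H n.*2.+1; rewrite -addnn -addSn leq_addl => /(_ isT).
rewrite exprVn => Hn; have := pow n.*2.+1.
move=> /le_trans/(_ (power_bounded n v)); rewrite ler_pM2r //.
apply/negP; rewrite -ltNge.
have P0 : 0 < rho ^+ n.*2.+1 by rewrite exprn_gt0.
rewrite -addnn -addSn in P0 *.
by move: Hn; rewrite -(ltr_pM2l P0) divff ?lt0r_neq0 //; lra.
Qed.

End PowerBound.

(* Kaplansky's theorem that [x^* x] is positive. *)
Theorem accretive_star_mul x : accretive (fun v => cstar x ** (x ** v)).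
Proof.
(* For such y, multiplication by y^* y or y y^* has norm at most 1/2, so both resolvents exist. *)
have small y v : nrm y ^+ 2 <= 1 / 2 -> nrm v <= nrm (v + cstar y ** (y ** v)).
  move=> y2.
  have bnd u w : nrm u ^+ 2 <= 1 / 2 -> nrm (cstar u ** (u ** w)) <= 1 / 2 * nrm w.
    move=> u2; apply: le_trans (nrmM _ _) _; rewrite nrm_cstar.
    apply: le_trans (ler_wpM2l (nrm_ge0 _) (nrmM _ _)) _.
    by rewrite mulrA -expr2 ler_wpM2r ?nrm_ge0.
  have adj u : adjoint_pair (fun v => cstar u ** (u ** v)) (fun v => cstar u ** (u ** v)).
    by move=> a b; rewrite !cstarE !cmulA.
  have lin u : linop (fun v => cstar u ** (u ** v)).
    by split=> [a b|c a]; rewrite !cmulE.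
  have [r [lr ar br Hr Kr]] := neumann_inverse (lin y) (adj y) (fun w => bnd y w y2).
  have y2' : nrm (cstar y) ^+ 2 <= 1 / 2 by rewrite nrm_cstar.
  have [r' [lr' ar' br' Hr' Kr']] :=
    neumann_inverse (lin (cstar y)) (adj (cstar y)) (fun w => bnd (cstar y) w y2').
  rewrite cstarK in Kr'.
  by rewrite -{1}(Kr v); apply: (resolvent_contraction lr lr' ar ar' br br' Hr Kr').
(* Raising s to s' makes x / sqrt(s') small; the surplus (s' - s) v is removed at the end by the
   triangle inequality. *)
move=> s v s0; set s' := s + 2 * nrm x ^+ 2.
have x0 := sqr_ge0 (nrm x).
have s'0 : 0 < s' by rewrite /s'; lra.
set t := Num.sqrt s'.
have t0 : 0 < t by rewrite sqrtr_gt0.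
have t2 : t ^+ 2 = s' by rewrite sqr_sqrtr // ltW.
have := small (t^-1%:C *: x) v; rewrite nrmZ gtr0_norm ?invr_gt0 // exprMn exprVn t2.
rewrite mulrC ler_pdivrMr // => H.
have {}H : nrm v <= nrm (v + s'^-1%:C *: (cstar x ** (x ** v))).
  have -> : s'^-1%:C *: (cstar x ** (x ** v)) =
      cstar (t^-1%:C *: x) ** (t^-1%:C *: x ** v).
    by rewrite cstarZc conjc_real !cmulE scalerA -t2; congr (_ *: _); rewrite -rmorphM /= expr2 invfM.
  by apply: H; rewrite /s'; lra.
have {}H : s' * nrm v <= nrm (s'%:C *: v + cstar x ** (x ** v)).
  have -> : s'%:C *: v + cstar x ** (x ** v) = s'%:C *: (v + s'^-1%:C *: (cstar x ** (x ** v))).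
    by rewrite scalerDr scalerA -rmorphM /= divff ?lt0r_neq0 // scale1r.
  by rewrite nrmZ gtr0_norm // ler_pM2l.
have : nrm (s'%:C *: v + cstar x ** (x ** v)) <=
    nrm (s%:C *: v + cstar x ** (x ** v)) + (s' - s) * nrm v.
  have -> : s'%:C *: v + cstar x ** (x ** v) =
    (s%:C *: v + cstar x ** (x ** v)) + (s' - s)%:C *: v by lmod.
  apply: le_trans (nrmD _ _) _; rewrite lerD2l nrmZ ger0_norm //.
  by rewrite /s'; lra.
by lra.
Qed.

(** Monotonicity of the norm for 0 <= x^* x <= n, up to the factor 20. For s > |n|, s - x^* x is the
    sum of s - n and z^* z, both accretive, so [selfadjoint_bound] applies to multiplication by x^*
    x. *)
Lemma nrm_star_mul_le x z : nrm x ^+ 2 <= 20 * nrm (cstar x ** x + cstar z ** z).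
Proof.
set n := cstar x ** x + cstar z ** z.
have main (s : R) : nrm n < s -> nrm x ^+ 2 <= 20 * s.
  move=> ns; have s0 : 0 < s := le_lt_trans (nrm_ge0 _) ns.
  have xx0 := sqr_ge0 (nrm x); have n0 := nrm_ge0 n.
  set f := cmul (cstar x ** x).
  have af : adjoint_pair f f by move=> a b; rewrite /f !cstarE !cmulA.
  have ax : accretive f.
    by have := accretive_star_mul x; apply: accretive_ext => v; rewrite /f cmulA.
  have az : accretive (cmul (cstar z ** z)).
    by have := accretive_star_mul z; apply: accretive_ext => v; rewrite cmulA.
  have bf : bounded_by f (nrm x ^+ 2) by move=> v; rewrite -nrm_cstar_id nrmM.
  have ap := accretive_shift (ltW s0) ax.
  have lsn : linop (fun v => s%:C *: v - n ** v).
    by split=> [a b|c a]; rewrite !cmulE; lmod.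
  have bz : bounded_by (cmul (cstar z ** z)) (nrm z ^+ 2 + 2 * s).
    move=> v; apply: le_trans (nrmM _ _) _; rewrite nrm_cstar_id.
    by rewrite ler_wpM2r ?nrm_ge0 // lerDl mulr_ge0 // ltW.
  have bsn : bounded_by (fun v => s%:C *: v - n ** v) (nrm z ^+ 2 + 2 * s).
    move=> v; apply: le_trans (nrmB _ _) _; rewrite nrmZ gtr0_norm //.
    have := nrmM n v; have := nrm_ge0 v; have := sqr_ge0 (nrm z); nra.
  have asn : accretive (fun v => s%:C *: v - n ** v).
    move=> t v t0; have := nrmB (t%:C *: v + (s%:C *: v - n ** v)) (- (n ** v)).
    have -> : t%:C *: v + (s%:C *: v - n ** v) - - (n ** v) = (t + s)%:C *: v by lmod.
    rewrite nrmN nrmZ gtr0_norm ?addr_gt0 //.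
    have := nrmM n v; have := nrm_ge0 v; nra.
  have k0 : 0 <= nrm z ^+ 2 + 2 * s by rewrite addr_ge0 ?sqr_ge0 ?mulr_ge0 ?ltW.
  have am : accretive (fun v => s%:C *: v - f v).
    have := accretiveD (linop_cmul (cstar z ** z)) lsn bz bsn k0 az asn.
    by apply: accretive_ext => v; rewrite /f /n cmulDl; lmod.
  (* Evaluated at x^* x itself, whose square has norm |x|^4. *)
  have := selfadjoint_bound (linop_cmul _) af s0 ap am bf (cstar x ** x).
  have E : cstar (cstar x ** x) = cstar x ** x by rewrite !cstarE.
  rewrite -{1}E !nrm_cstar_id.
  have [->|x1] := eqVneq (nrm x ^+ 2) 0; first by move=> _; rewrite mulr_ge0 // ltW.
  by rewrite expr2 ler_pM2r // lt0r x1.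
apply/ler_addgt0Pr => e e0.
have := main (nrm n + e / 20); rewrite ltrDl divr_gt0 // => /(_ isT); lra.
Qed.

End Kaplansky.

(** * Resolvents of self-adjoint operators *)

Section Inner.
Context (R : realType) (B : cstarAlgType R) (E : hilbertModType B).
Implicit Types (x y z : E).

Lemma innerDl x y z : ⟨x + y | z⟩ = ⟨x | z⟩ + ⟨y | z⟩.
Proof. by rewrite -inner_star innerDr cstarD !inner_star. Qed.

Lemma innerZl (a : R[i]) x y : ⟨a *: x | y⟩ = conjc a *: ⟨x | y⟩.
Proof. by rewrite -inner_star innerZr cstarZc inner_star. Qed.

Lemma innerNl x y : ⟨- x | y⟩ = - ⟨x | y⟩.
Proof. by rewrite -scaleN1r innerZl rmorphN rmorph1 scaleN1r. Qed.

Lemma innerNr x y : ⟨x | - y⟩ = - ⟨x | y⟩.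
Proof. by rewrite -scaleN1r innerZr scaleN1r. Qed.

Lemma inner0r x : ⟨x | 0⟩ = 0.
Proof. by have := innerZr 0 x 0; rewrite !scale0r. Qed.

Lemma inner0l x : ⟨0 | x⟩ = 0.
Proof. by have := innerZl 0 0 x; rewrite rmorph0 !scale0r. Qed.

Definition innerE :=
  (innerDl, @innerDr R B E, innerNl, innerNr, innerZl, @innerZr R B E).

Lemma nrm_inner x : nrm ⟨x | x⟩ = nrm x ^+ 2.
Proof. by apply: complexI; rewrite rmorphXn /= -!nrmE normr_inner. Qed.

Lemma nrm_eq_inner x y : ⟨x | x⟩ = ⟨y | y⟩ -> nrm x = nrm y.
Proof.
move=> xy; apply: (@pexpIrn _ 2) => //; rewrite ?nnegrE ?nrm_ge0 //.
by rewrite -!nrm_inner xy.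
Qed.

(* Polarization; the constant 4 could be improved to 1. *)
Lemma inner_bound x y : nrm ⟨x | y⟩ <= 4 * (nrm x * nrm y).
Proof.
have pol (u v : E) : nrm ⟨u | v⟩ <= (nrm u + nrm v) ^+ 2.
  have E4 : 4%:C *: ⟨u | v⟩ = (⟨u + v | u + v⟩ - ⟨u - v | u - v⟩) -
    'i *: (⟨u + 'i *: v | u + 'i *: v⟩ - ⟨u - 'i *: v | u - 'i *: v⟩).
    by rewrite !innerE; lmod.
  have sq (a b : E) : nrm b = nrm v -> nrm a = nrm u ->
      nrm (⟨a + b | a + b⟩ - ⟨a - b | a - b⟩) <= 2 * (nrm u + nrm v) ^+ 2.
    move=> bv au; apply: le_trans (nrmB _ _) _; rewrite !nrm_inner.
    have H1 := nrmD a b; have H2 := nrmB a b; have := nrm_ge0 (a + b).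
    by have := nrm_ge0 (a - b); rewrite -bv -au; nra.
  have := nrmZ 4 ⟨u | v⟩; rewrite E4 ger0_norm // => E5.
  have H1 := sq u v erefl erefl.
  have H2 := sq u ('i *: v) (nrmiZ v) erefl.
  have := nrmB (⟨u + v | u + v⟩ - ⟨u - v | u - v⟩)
    ('i *: (⟨u + 'i *: v | u + 'i *: v⟩ - ⟨u - 'i *: v | u - 'i *: v⟩)).
  by rewrite nrmiZ E5; lra.
have [x0|x0] := eqVneq (nrm x) 0.
  by rewrite (nrm0_eq0 x0) inner0l !nrm0 mul0r mulr0.
have [y0|y0] := eqVneq (nrm y) 0.
  by rewrite (nrm0_eq0 y0) inner0r !nrm0 !mulr0.
have xp : 0 < nrm x by rewrite lt0r x0 nrm_ge0.
have yp : 0 < nrm y by rewrite lt0r y0 nrm_ge0.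
(* On unit vectors the bound (|u| + |v|)^2 is 4. *)
have := pol ((nrm x)^-1%:C *: x) ((nrm y)^-1%:C *: y).
rewrite innerZl innerZr conjc_real !nrmZ !gtr0_norm ?invr_gt0 // !mulVf //.
rewrite mulrA -invfM mulrC ler_pdivrMr ?mulr_gt0 //.
by lra.
Qed.

End Inner.

(** * Resolvents at imaginary points *)

Section Resolvent.
Context (R : realType) (B : cstarAlgType R) (E : hilbertModType B).
Implicit Types (T : operator E) (x y z : E) (s : R).

Definition im s : R[i] := Complex 0 s.

Lemma nrm_imZ s x : nrm (im s *: x) = `|s| * nrm x.
Proof.
by apply: complexI; rewrite rmorphM /= -!nrmE normrZ normc_def /= expr0n add0r sqrtr_sqr.
Qed.

Lemma domD T x y : dom T x -> dom T y -> dom T (x + y).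
Proof. exact: (submoduleD (dom_submodule T)). Qed.

Lemma domZ T (a : R[i]) x : dom T x -> dom T (a *: x).
Proof. exact: (submoduleZ (dom_submodule T)). Qed.

Lemma domN T x : dom T x -> dom T (- x).
Proof. by rewrite -scaleN1r; exact: domZ. Qed.

Lemma domB T x y : dom T x -> dom T y -> dom T (x - y).
Proof. by move=> ? ?; apply: domD => //; apply: domN. Qed.

Lemma opfunN T x : dom T x -> T (- x) = - T x.
Proof. by move=> dx; rewrite -scaleN1r opfunZ // scaleN1r. Qed.

Lemma opfunB T x y : dom T x -> dom T y -> T (x - y) = T x - T y.
Proof. by move=> dx dy; rewrite opfunD ?opfunN //; apply: domN. Qed.

Lemma closed_operator_lim T x y : closed_operator T ->
  (forall e, 0 < e -> exists u, [/\ dom T u, nrm (x - u) < e & nrm (y - T u) < e]) ->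
  dom T x /\ T x = y.
Proof.
move=> cT H; have [|/= ? ->] // := cT (x, y).
apply/closure_nrm => e /H[u [du xu yu]].
by exists (u, T u).
Qed.

(** The default 0 stands for a missing solution; [range_full] excludes this for regular self-adjoint
    [T] and s != 0. *)
Definition resolvent T s y : E := xget 0 [set x | dom T x /\ T x + im s *: x = y].

Definition regular_selfadjoint T : Prop := regular T /\ selfadjoint T.

Section RegularSelfadjoint.
Context (T : operator E) (rsT : regular_selfadjoint T).

Lemma rs_closed : closed_operator T.
Proof. by case: rsT => -[]. Qed.

Lemma rs_symmetric x y : dom T x -> dom T y -> ⟨T x | y⟩ = ⟨x | T y⟩.
Proof.
move=> dx dy; have [_ [_ TT]] := rsT.
have : graph T (y, T y) by [].
by rewrite TT => /(_ x dx).
Qed.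

(** Both vectors have inner square ⟨T x | T x⟩ + s^2 ⟨x | x⟩ by symmetry. Half their difference and
    half their sum then bound |s| |x| and |T x|. *)
Lemma rs_isometry s x : dom T x -> nrm (T x + im s *: x) = nrm (T x - im s *: x).
Proof.
move=> dx; apply: nrm_eq_inner; rewrite !innerE (rs_symmetric dx dx).
by lmod.
Qed.

Lemma rs_lower s x : dom T x -> `|s| * nrm x <= nrm (T x + im s *: x).
Proof.
move=> dx; rewrite -nrm_imZ; have E1 := rs_isometry s dx.
have := nrmB (T x + im s *: x) (T x - im s *: x).
have -> : T x + im s *: x - (T x - im s *: x) = 2%:C *: (im s *: x) by lmod.
by rewrite nrmZ ger0_norm // -E1; lra.
Qed.

Lemma rs_lower_op s x : dom T x -> nrm (T x) <= nrm (T x + im s *: x).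
Proof.
move=> dx; have E1 := rs_isometry s dx.
have := nrmD (T x + im s *: x) (T x - im s *: x).
have -> : T x + im s *: x + (T x - im s *: x) = 2%:C *: T x by lmod.
by rewrite nrmZ ger0_norm // -E1; lra.
Qed.

Let in_range s y := exists x, dom T x /\ T x + im s *: x = y.

(** For s^2 = 1, 1 + T^2 = (T + i s)(T - i s), so the dense range given by regularity lies in the
    range of T + i s. *)
Let range_dense s y e : s ^+ 2 = 1 -> 0 < e ->
  exists2 y', in_range s y' & nrm (y - y') < e.
Proof.
move=> s2 e0; have [[_ _ [Ts [TTs _ dTs]]] [_ TT]] := rsT.
have [_ [x [dx dTx ->]] H] := dense_nrm y dTs e0.
have graphE : graph Ts = graph T by rewrite TT TTs.
have [/= dx' TxE] : graph T (T x, Ts (T x)) by rewrite -graphE.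
exists (x + Ts (T x)) => //.
exists (T x - im s *: x); split; first by apply: domB => //; apply: domZ.
rewrite opfunB //; last exact: domZ.
rewrite opfunZ // TxE.
transitivity ((s ^+ 2)%:C *: x + T (T x)); first by lmod.
by rewrite s2 scale1r.
Qed.

(** The range is closed: preimages of approximations at rate 2^-n converge by [rs_lower], and T is
    closed. *)
Let range_unit s y : s ^+ 2 = 1 -> in_range s y.
Proof.
move=> s2.
have s1 : `|s| = 1.
  by apply/eqP; rewrite -(@eqrXn2 _ 2) // real_normK ?num_real // s2 expr1n.
have [u Hu] : exists u : nat -> E, forall n, dom T (u n) /\
    nrm (y - (T (u n) + im s *: u n)) < (1 / 2) ^+ n.
  have H n : exists x, dom T x /\ nrm (y - (T x + im s *: x)) < (1 / 2) ^+ n.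
    have p0 : 0 < (1 / 2 : R) ^+ n by apply: exprn_gt0; lra.
    by have [_ [x [dx <-]] Hx] := range_dense y s2 p0; exists x.
  by exists (fun n => projT1 (cid (H n))) => n; case: cid.
have diff n : nrm ((T (u n.+1) + im s *: u n.+1) - (T (u n) + im s *: u n)) <=
    2 * (1 / 2) ^+ n.
  have [_ H1] := Hu n; have [_ H2] := Hu n.+1.
  have := nrmB (y - (T (u n) + im s *: u n)) (y - (T (u n.+1) + im s *: u n.+1)).
  have -> : (y - (T (u n) + im s *: u n)) - (y - (T (u n.+1) + im s *: u n.+1)) =
    (T (u n.+1) + im s *: u n.+1) - (T (u n) + im s *: u n) by lmod.
  move: H2; rewrite exprS; have : 0 <= (1 / 2 : R) ^+ n by apply: exprn_ge0; lra.
  by lra.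
have du n : nrm (u n.+1 - u n) <= 2 * (1 / 2) ^+ n.
  apply: le_trans (diff n); have [d0 _] := Hu n; have [d1 _] := Hu n.+1.
  have := rs_lower s (domB d1 d0); rewrite s1 mul1r opfunB //.
  by congr (_ <= nrm _); lmod.
have [l Hl] := geometric_complete (ltac:(lra) : 0 <= 1 / 2) (ltac:(lra) : 1 / 2 < 1) du.
exists l; suff [dl Tl] : dom T l /\ T l = y - im s *: l.
  by split=> //; rewrite Tl subrK.
apply: (closed_operator_lim rs_closed) => e e0.
have [|n /(_ n (leqnn _)) Hn] := @expr_small R (1 / 2) (e / 8) ltac:(lra) ltac:(lra).
  by rewrite divr_gt0.
have [dn Hyn] := Hu n; have Hln := Hl n; have p0 : 0 <= (1 / 2 : R) ^+ n.
  by apply: exprn_ge0; lra.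
have {}Hln : nrm (u n - l) <= 4 * (1 / 2) ^+ n by apply: le_trans Hln _; rewrite ler_pdivrMr; lra.
exists (u n); split=> //; first by rewrite nrmBC; lra.
have -> : y - im s *: l - T (u n) = (y - (T (u n) + im s *: u n)) + im s *: (u n - l).
  by lmod.
apply: le_lt_trans (nrmD _ _) _; rewrite nrm_imZ s1 mul1r; lra.
Qed.

(** T + i s' = (1 + i (s' - s) P)(T + i s) with P = (T + i s)^-1 of norm at most 1/|s|; a Neumann
    series inverts the first factor. *)
Let range_step s s' : (forall y, in_range s y) -> `|s' - s| < `|s| ->
  forall y, in_range s' y.
Proof.
move=> rs ss' y; have s0 : 0 < `|s| := le_lt_trans (normr_ge0 _) ss'.
have [P HP] : exists P : E -> E, forall y, dom T (P y) /\ T (P y) + im s *: P y = y.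
  by exists (fun y => projT1 (cid (rs y))) => z; case: cid.
have PB a b : P (a - b) = P a - P b.
  have [da Ta] := HP a; have [db Tb] := HP b; have [dab Tab] := HP (a - b).
  apply/eqP; rewrite -subr_eq0; apply/eqP/nrm0_eq0/le_anti.
  rewrite nrm_ge0 andbT -(ler_pM2l s0) mulr0.
  apply: le_trans (rs_lower s (domB dab (domB da db))) _.
  have -> : T (P (a - b) - (P a - P b)) + im s *: (P (a - b) - (P a - P b)) =
      (T (P (a - b)) + im s *: P (a - b)) -
      ((T (P a) + im s *: P a) - (T (P b) + im s *: P b)).
    by rewrite !opfunB //; [lmod | apply: domB].
  by rewrite Ta Tb Tab subrr nrm0.
pose q := `|s' - s| / `|s|.
have q0 : 0 <= q by rewrite divr_ge0.
have q1 : q < 1 by rewrite ltr_pdivrMr // mul1r.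
have [w Hw] : exists w, w + im (s' - s) *: P w = y.
  apply: (neumann y q0 q1) => [a b|z]; first by rewrite PB scalerBr.
  rewrite nrm_imZ /q -mulrA ler_wpM2l //.
  rewrite mulrC ler_pdivlMr // mulrC; have [dz Hz] := HP z.
  by have := rs_lower s dz; rewrite Hz.
exists (P w); have [dw Tw] := HP w; split=> //.
transitivity ((T (P w) + im s *: P w) + im (s' - s) *: P w); first by lmod.
by rewrite Tw Hw.
Qed.

(** Points with 0 < |s| <= 1 are one step away from 1 or -1; beyond, one goes from 2s/3 to s, by
    induction on n with |s| <= (3/2)^n. *)
Lemma range_full s y : s != 0 -> in_range s y.
Proof.
have step n : forall s, 0 < `|s| -> `|s| <= (3 / 2) ^+ n -> forall y, in_range s y.
  elim: n => [|n IH] {y}s s0 sn y.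
    rewrite expr0 in sn; case: (ltrgt0P s) => [sp|sm|s00]; last first.
    - by rewrite s00 normr0 ltxx in s0.
    - apply: (@range_step (-1)); first by move=> z; apply: range_unit; rewrite sqrrN expr1n.
      rewrite opprK normrN1; rewrite ltr0_norm // in s0 sn.
      by rewrite ltr_norml; apply/andP; split; lra.
    - apply: (@range_step 1); first by move=> z; apply: range_unit; rewrite expr1n.
      rewrite normr1; rewrite gtr0_norm // in s0 sn.
      by rewrite ltr_norml; apply/andP; split; lra.
  have nM (c : R) : 0 <= c -> `|c * s| = c * `|s| by move=> c0; rewrite normrM ger0_norm.
  apply: (@range_step (2 / 3 * s)).
    apply: IH; rewrite nM; [ | lra | | lra]; first by rewrite mulr_gt0 //; lra.
    by move: sn; rewrite exprS; lra.
  have -> : s - 2 / 3 * s = 1 / 3 * s by lra.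
  by rewrite !nM; lra.
move=> s0; have sp : 0 < `|s| by rewrite normr_gt0.
have si : 0 < `|s|^-1 by rewrite invr_gt0.
have [n /(_ n (leqnn _)) Hn] :=
  expr_small (ltac:(lra) : 0 <= 2 / 3) (ltac:(lra) : 2 / 3 < 1) si.
apply: (step n) => //.
have p0 : 0 < (3 / 2 : R) ^+ n by apply: exprn_gt0; lra.
have E1 : (2 / 3 : R) ^+ n * (3 / 2) ^+ n = 1.
  have E2 : 2 / 3 * (3 / 2) = 1 :> R by lra.
  by rewrite -exprMn E2 expr1n.
move: Hn; rewrite -(ltr_pM2l sp) divff ?lt0r_neq0 // => Hn.
by rewrite -[leRHS]mul1r -[leLHS]mulr1 -{1}E1 mulrA ler_pM2r // ltW.
Qed.

Section At.
Context (s : R) (s0 : s != 0).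

Let resP y : dom T (resolvent T s y) /\ T (resolvent T s y) + im s *: resolvent T s y = y.
Proof. exact: (xgetPex 0 (range_full y s0)). Qed.

Lemma resolvent_dom y : dom T (resolvent T s y).
Proof. by case: (resP y). Qed.

Lemma resolventK y : T (resolvent T s y) + im s *: resolvent T s y = y.
Proof. by case: (resP y). Qed.

Lemma op_resolvent y : T (resolvent T s y) = y - im s *: resolvent T s y.
Proof. by rewrite -{2}(resolventK y) addrK. Qed.

Let sp : 0 < `|s|. Proof. by rewrite normr_gt0. Qed.

Lemma resolvent_uniq x y : dom T x -> T x + im s *: x = y -> resolvent T s y = x.
Proof.
move=> dx Tx; have dr := resolvent_dom y.
apply/eqP; rewrite -subr_eq0; apply/eqP/nrm0_eq0/le_anti.
rewrite nrm_ge0 andbT -(ler_pM2l sp) mulr0.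
apply: le_trans (rs_lower s (domB dr dx)) _.
rewrite opfunB //.
have -> : T (resolvent T s y) - T x + im s *: (resolvent T s y - x) =
  (T (resolvent T s y) + im s *: resolvent T s y) - (T x + im s *: x) by lmod.
by rewrite resolventK Tx subrr nrm0.
Qed.

Lemma resolventD x y : resolvent T s (x + y) = resolvent T s x + resolvent T s y.
Proof.
have dx := resolvent_dom x; have dy := resolvent_dom y.
apply: resolvent_uniq; first exact: domD.
rewrite opfunD // -[in RHS](resolventK x) -[in RHS](resolventK y).
by lmod.
Qed.

Lemma resolventZ a x : resolvent T s (a *: x) = a *: resolvent T s x.
Proof.
have dx := resolvent_dom x.
apply: resolvent_uniq; first exact: domZ.
by rewrite opfunZ // -[in RHS](resolventK x); lmod.
Qed.

Lemma resolventB x y : resolvent T s (x - y) = resolvent T s x - resolvent T s y.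
Proof. by rewrite resolventD -scaleN1r resolventZ scaleN1r. Qed.

Lemma resolvent_le y : `|s| * nrm (resolvent T s y) <= nrm y.
Proof. by have := rs_lower s (resolvent_dom y); rewrite resolventK. Qed.

Lemma op_resolvent_le y : nrm (T (resolvent T s y)) <= nrm y.
Proof. by have := rs_lower_op s (resolvent_dom y); rewrite resolventK. Qed.

Lemma resolvent_op x : dom T x -> resolvent T s (T x) = T (resolvent T s x).
Proof.
move=> dx; have dr := resolvent_dom x.
rewrite op_resolvent -{1}(addrK (im s *: x) (T x)) resolventB resolventZ.
by rewrite (resolvent_uniq dx erefl).
Qed.

End At.

Lemma resolvent_adjoint s x y : s != 0 ->
  ⟨resolvent T s x | y⟩ = ⟨x | resolvent T (- s) y⟩.
Proof.
move=> s0; have ms0 : - s != 0 by rewrite oppr_eq0.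
have dx := resolvent_dom s0 x; have dy := resolvent_dom ms0 y.
rewrite -{1}(resolventK ms0 y) -{2}(resolventK s0 x) !innerE (rs_symmetric dx dy).
by lmod.
Qed.

(** T (T + i s)^-1 is a contraction, and on u in the dense domain it gives (T + i s)^-1 T u, of size
    O(1/|s|). *)
Lemma op_resolvent_small x e : 0 < e ->
  exists2 s1 : R, 0 < s1 & forall s, s1 <= `|s| -> nrm (T (resolvent T s x)) <= e.
Proof.
move=> e0; have [_ [dT _]] := rsT.
have e20 : 0 < e / 2 by rewrite divr_gt0.
have [u du xu] := dense_nrm x dT e20.
have n0 := nrm_ge0 (T u).
exists (2 * (nrm (T u) + 1) / e).
  by rewrite divr_gt0 ?mulr_gt0 // ltr_wpDl.
move=> s; rewrite ler_pdivrMr // => Hs.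
have sp : 0 < `|s|.
  rewrite lt0r normr_ge0 andbT; apply/eqP => s0; move: Hs; rewrite s0; lra.
have s0 : s != 0 by rewrite -normr_gt0.
have -> : T (resolvent T s x) = T (resolvent T s (x - u)) + T (resolvent T s u).
  by rewrite !op_resolvent // resolventB //; lmod.
apply: le_trans (nrmD _ _) _; rewrite [leRHS](splitr e) lerD //.
  by apply: le_trans (op_resolvent_le s0 _) _; exact: ltW.
rewrite -resolvent_op // -(ler_pM2l sp).
by apply: le_trans (resolvent_le s0 _) _; lra.
Qed.

End RegularSelfadjoint.

End Resolvent.

(** * Weakly commuting operators *)

Section WeaklyCommuting.
Context (R : realType) (B : cstarAlgType R) (E : hilbertModType B).
Implicit Types (S T : operator E) (x y z u v w : E) (s t C e : R).

Definition commutator_bound S T C : Prop := forall x, commutator_dom S T x ->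
  nrm (commutator S T x) <= C * (nrm x + nrm (S x) + nrm (T x)).

Lemma commutator_domC S T x : commutator_dom S T x -> commutator_dom T S x.
Proof. by case. Qed.

Lemma commutatorC S T x : commutator T S x = - commutator S T x.
Proof. by rewrite opprB. Qed.

Lemma commutator_boundC S T C : commutator_bound S T C -> commutator_bound T S C.
Proof.
move=> H x dx; rewrite commutatorC nrmN; apply: le_trans (H x (commutator_domC dx)) _.
by rewrite addrAC.
Qed.

Lemma commutator_domB S T x y : commutator_dom S T x -> commutator_dom S T y ->
  commutator_dom S T (x - y).
Proof.
move=> [Sx Tx TSx STx] [Sy Ty TSy STy].
by split; rewrite ?opfunB //; apply: domB.
Qed.

Lemma commutatorB S T x y : commutator_dom S T x -> commutator_dom S T y ->
  commutator S T (x - y) = commutator S T x - commutator S T y.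
Proof.
move=> [Sx Tx TSx STx] [Sy Ty TSy STy].
by rewrite /commutator !(opfunB (T := S), opfunB (T := T)) //; lmod.
Qed.

(** With k = [S,T] x, the order inequality writes C ⟨x | x⟩_{S,T} as ⟨k | k⟩ + c^* c, so
    [nrm_star_mul_le] bounds |k|^2. The constant 20 C + 1 avoids a square root of 20 C. *)
Lemma weakly_commuting_bound S T : weakly_commuting S T ->
  exists2 C : R, 0 < C & commutator_bound S T C.
Proof.
move=> [[C C0 H] _]; exists (20 * C + 1); first by rewrite addr_gt0 ?mulr_gt0.
move=> x dx; have [c Hc] := H x dx.
set k := commutator S T x in Hc *.
have [d Hd] := inner_pos k.
have nd : nrm d ^+ 2 = nrm k ^+ 2 by rewrite -nrm_inner Hd nrm_cstar_id.
have := nrm_star_mul_le d c; rewrite nd -Hd -Hc.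
have -> : ⟨k | k⟩ + (C%:C *: inner2 S T x x - ⟨k | k⟩) = C%:C *: inner2 S T x x.
  by rewrite addrC subrK.
rewrite nrmZ gtr0_norm // => Hk.
have Hin : nrm (inner2 S T x x) <= nrm x ^+ 2 + nrm (S x) ^+ 2 + nrm (T x) ^+ 2.
  by apply: le_trans (nrmD _ _) _; rewrite -!nrm_inner lerD2r nrmD.
have x0 := nrm_ge0 x; have s0 := nrm_ge0 (S x); have t0 := nrm_ge0 (T x).
set m := nrm x + nrm (S x) + nrm (T x).
have m0 : 0 <= m by rewrite !addr_ge0.
have Hm : nrm (inner2 S T x x) <= m ^+ 2 by apply: le_trans Hin _; rewrite /m; nra.
rewrite leNgt; apply/negP => Hlt.
have : ((20 * C + 1) * m) ^+ 2 < nrm k ^+ 2.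
  by rewrite ltrXn2r ?mulr_ge0 //; lra.
suff : 20 * (C * nrm (inner2 S T x x)) <= ((20 * C + 1) * m) ^+ 2 by lra.
have H2 : C * nrm (inner2 S T x x) <= C * m ^+ 2 by rewrite ler_pM2l.
have -> : ((20 * C + 1) * m) ^+ 2 = (400 * C ^+ 2 + 40 * C + 1) * m ^+ 2 by ring.
have := sqr_ge0 m; have := sqr_ge0 C; nra.
Qed.

Section Bounded.
Context (S T : operator E) (C : R).
Hypotheses (rsS : regular_selfadjoint S) (rsT : regular_selfadjoint T)
  (C0 : 0 < C) (bC : commutator_bound S T C).

Lemma op_commutator_dom s x : commutator_dom S T x ->
  S (T x) + im s *: T x = T (S x + im s *: x) + commutator S T x.
Proof.
move=> [Sx Tx TSx STx]; rewrite opfunD ?opfunZ //; last exact: domZ.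
by rewrite /commutator; lmod.
Qed.

(** Let y = (S + i s) x. Then |s| |T x| <= |(S + i s) T x| = |T y + [S,T] x|. The commutator is at
    most 2 C |y| + C |T x|, and C |T x| is absorbed since 2 C <= |s|. *)
Lemma commutator_dom_estimate s x : 1 <= `|s| -> 2 * C <= `|s| ->
  commutator_dom S T x ->
  `|s| * nrm (T x) <= 2 * (nrm (T (S x + im s *: x)) + 2 * C * nrm (S x + im s *: x)).
Proof.
move=> s1 sC dx; have [Sx Tx TSx STx] := dx.
have := rs_lower rsS s STx; rewrite op_commutator_dom //.
have := nrmD (T (S x + im s *: x)) (commutator S T x).
have bk := bC dx; have lx := rs_lower rsS s Sx; have lSx := rs_lower_op rsS s Sx.
have x0 := nrm_ge0 x; have Tx0 := nrm_ge0 (T x).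
set y := S x + im s *: x in lx lSx * => Hk Hl.
have nx : nrm x <= nrm y by nra.
have : C * nrm x <= C * nrm y by rewrite ler_pM2l.
have : C * nrm (S x) <= C * nrm y by rewrite ler_pM2l.
have : 2 * C * nrm (T x) <= `|s| * nrm (T x) by rewrite ler_wpM2r.
lra.
Qed.

Definition resolvent_invariant s : Prop :=
  forall y, dom T y -> commutator_dom S T (resolvent S s y).

(** Approximate y by core elements u_n in the graph norm of T, at rate 2^-n. The previous estimate,
    applied to differences of x_n = (S + i s)^-1 u_n, makes T x_n and [S,T] x_n converge; closedness
    of T and then of S gives the claim. *)
Lemma core_resolvent_invariant s (D : set E) : 1 <= `|s| -> 2 * C <= `|s| ->
  core T D -> resolvent_image S (im s) D `<=` commutator_dom S T ->
  resolvent_invariant s.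
Proof.
move=> s1 sC [_ DT cD] imD y dy; have Cp := C0.
have s0 : s != 0 by rewrite -normr_gt0; lra.
have sp : 0 < `|s| by lra.
have q0 : 0 <= 1 / 2 :> R by lra.
have q1 : 1 / 2 < 1 :> R by lra.
have qn n : 0 < (1 / 2 : R) ^+ n by apply: exprn_gt0; lra.
have [u Hu] : exists u : nat -> E, forall n, [/\ D (u n),
    nrm (y - u n) < (1 / 2) ^+ n & nrm (T y - T (u n)) < (1 / 2) ^+ n].
  have H n : exists u, [/\ D u, nrm (y - u) < (1 / 2) ^+ n &
       nrm (T y - T u) < (1 / 2) ^+ n].
    have : closure (graph_on T D) (y, T y) by rewrite cD.
    move/closure_nrm => /(_ _ (qn n)) [[a b] /= [[/= Da ->] ? ?]].
    by exists a.
  by exists (fun n => projT1 (cid (H n))) => n; case: cid.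
pose x n := resolvent S s (u n).
have dx n : commutator_dom S T (x n).
  apply: imD; split; first exact: resolvent_dom.
  by rewrite resolventK //; case: (Hu n).
have du n : dom T (u n) by apply: DT; case: (Hu n).
have dif n : nrm (u n.+1 - u n) <= 2 * (1 / 2) ^+ n /\
    nrm (T (u n.+1 - u n)) <= 2 * (1 / 2) ^+ n.
  have [_ a0 b0] := Hu n; have [_ a1 b1] := Hu n.+1; have := qn n.
  rewrite !exprS in a1 b1; rewrite opfunB //.
  have -> : u n.+1 - u n = (y - u n) - (y - u n.+1) by lmod.
  have -> : T (u n.+1) - T (u n) = (T y - T (u n)) - (T y - T (u n.+1)) by lmod.
  have := nrmB (y - u n) (y - u n.+1); have := nrmB (T y - T (u n)) (T y - T (u n.+1)).
  by split; lra.
have xK n : S (x n.+1 - x n) + im s *: (x n.+1 - x n) = u n.+1 - u n.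
  by rewrite /x -resolventB // resolventK.
(* This is 2 (2 + 2 C * 2): both norms in [commutator_dom_estimate] are at most 2 (1/2)^n. *)
pose M := 4 * (1 + 2 * C).
have difT n : nrm (T (x n.+1) - T (x n)) <= M * (1 / 2) ^+ n.
  have [_ T1 _ _] := dx n.+1; have [_ T0 _ _] := dx n.
  have := commutator_dom_estimate s1 sC (commutator_domB (dx n.+1) (dx n)).
  rewrite xK opfunB //; have [d1 d2] := dif n => H.
  have n0 := nrm_ge0 (T (x n.+1) - T (x n)).
  apply: le_trans (_ : `|s| * nrm (T (x n.+1) - T (x n)) <= _).
    by rewrite -{1}[nrm _]mul1r ler_wpM2r.
  apply: le_trans H _.
  have : C * nrm (u n.+1 - u n) <= C * (2 * (1 / 2) ^+ n) by rewrite ler_pM2l.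
  by rewrite /M; lra.
have difx n : nrm (x n.+1 - x n) <= 2 * (1 / 2) ^+ n.
  have := resolvent_le rsS s0 (u n.+1 - u n); rewrite resolventB // -/(x _) -/(x _).
  have [d1 _] := dif n; have n0 := nrm_ge0 (x n.+1 - x n).
  have : 0 <= (`|s| - 1) * nrm (x n.+1 - x n) by rewrite mulr_ge0 //; lra.
  by lra.
have difS n : nrm (S (x n.+1 - x n)) <= 2 * (1 / 2) ^+ n.
  have := op_resolvent_le rsS s0 (u n.+1 - u n); rewrite resolventB // -/(x _) -/(x _).
  by have [d1 _] := dif n; lra.
pose k n := commutator S T (x n).
have difk n : nrm (k n.+1 - k n) <= C * (4 + M) * (1 / 2) ^+ n.
  have [_ T1 _ _] := dx n.+1; have [_ T0 _ _] := dx n.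
  rewrite /k -commutatorB //.
  apply: le_trans (bC (commutator_domB (dx n.+1) (dx n))) _.
  rewrite (opfunB T1 T0); have h1 := difx n; have h2 := difS n; have h3 := difT n.
  by rewrite -mulrA ler_pM2l //; lra.
have [v Hv] := geometric_complete q0 q1 difT.
have [l Hl] := geometric_complete q0 q1 difk.
have M4 : 4 < M by rewrite /M; lra.
have CM0 : 0 < C * (4 + M) by rewrite mulr_gt0 //; lra.
have lim e : 0 < e -> exists n, [/\ (1 / 2) ^+ n < e, nrm (T (x n) - v) < e &
    nrm (k n - l) < e].
  move=> e0; pose K := 2 * (C * (4 + M) + M) + 1.
  have K0 : 0 < K by rewrite /K; lra.
  have [n /(_ n (leqnn _)) Hn] := expr_small q0 q1 (divr_gt0 e0 K0).
  rewrite ltr_pdivlMr // in Hn; have p0 := qn n.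
  have h1 : 0 < M * (1 / 2) ^+ n by rewrite mulr_gt0 //; lra.
  have h2 : 0 < C * (4 + M) * (1 / 2) ^+ n by rewrite mulr_gt0.
  have half (a : R) : a / (1 - 1 / 2) = 2 * a by field; lra.
  have Hvn := Hv n; have Hln := Hl n; rewrite !half in Hvn Hln.
  by exists n; split; rewrite /K in Hn; lra.
have xy n : nrm (resolvent S s y - x n) <= (1 / 2) ^+ n.
  have [_ yu _] := Hu n; have := resolvent_le rsS s0 (y - u n).
  rewrite resolventB // -/(x n); have n0 := nrm_ge0 (resolvent S s y - x n).
  have : 0 <= (`|s| - 1) * nrm (resolvent S s y - x n) by rewrite mulr_ge0 //; lra.
  by lra.
have [dTP TP] : dom T (resolvent S s y) /\ T (resolvent S s y) = v.
  apply: (closed_operator_lim (rs_closed rsT)) => e e0; have [n [n1 n2 _]] := lim e e0.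
  exists (x n); split; first by case: (dx n).
    exact: le_lt_trans (xy n) n1.
  by rewrite nrmBC.
have [dSv _] : dom S v /\ S v = T y + l - im s *: v.
  apply: (closed_operator_lim (rs_closed rsS)) => e e0.
  have e1 : 0 < e / (3 + `|s|) by rewrite divr_gt0 //; lra.
  have [n [n1 n2 n3]] := lim _ e1; have [Sx Tx TSx STx] := dx n.
  have le1 : e / (3 + `|s|) < e by rewrite ltr_pdivrMr //; nra.
  exists (T (x n)); split=> //; first by rewrite nrmBC; apply: lt_trans n2 le1.
  (* Writes S T x_n through convergent sequences, so that closedness of S applies to T x_n. *)
  have STE : S (T (x n)) = T (u n) + k n - im s *: T (x n).
    have := op_commutator_dom s (dx n); rewrite {1 2}/x resolventK // -/(x n) => <-.
    by rewrite addrK.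
  have [_ _ Tyu] := Hu n.
  have -> : T y + l - im s *: v - S (T (x n)) =
     (T y - T (u n)) - (k n - l) + im s *: (T (x n) - v) by rewrite STE; lmod.
  apply: le_lt_trans (nrmD _ _) _; rewrite nrm_imZ.
  have := nrmB (T y - T (u n)) (k n - l).
  have : `|s| * nrm (T (x n) - v) <= `|s| * (e / (3 + `|s|)) by rewrite ler_pM2l // ltW.
  have : (3 + `|s|) * (e / (3 + `|s|)) = e by rewrite mulrC divfK // lt0r_neq0 //; lra.
  by lra.
split=> //; first exact: resolvent_dom; last by rewrite TP.
by rewrite op_resolvent //; apply: domB => //; apply: domZ.
Qed.

(* [1 + [S, T] (S + i s)^-1 (T + i t)^-1] is invertible for large [t]; applying
   [(S + i s)^-1 (T + i t)^-1] to its inverse gives [(T + i t)^-1 (S + i s)^-1]. *)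
Lemma resolvent_invariant_swap s : 1 <= `|s| -> 8 * C <= `|s| ->
  resolvent_invariant s ->
  exists2 t0 : R, 0 < t0 & forall t, t0 <= `|t| -> forall v, dom S v ->
    commutator_dom S T (resolvent T t v).
Proof.
move=> s1 sC inv; have Cp := C0; exists (12 * C + 1); first lra.
have s0 : s != 0 by rewrite -normr_gt0; lra.
move=> t tC v dv; have tp : 0 < `|t| by lra.
have t0 : t != 0 by rewrite -normr_gt0.
pose Q := resolvent T t; pose P := resolvent S s.
pose L u := commutator S T (P (Q u)).
have dQ u : dom T (Q u) by exact: resolvent_dom.
have dPQ u : commutator_dom S T (P (Q u)) by apply: inv.
have LB a b : L (a - b) = L a - L b.
  rewrite /L -commutatorB //; congr (commutator S T _).
  by rewrite /P /Q !resolventB.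
(* Since 12 C <= |t| and 8 C <= |s|, the three terms of the commutator bound are at most 1/12, 1/12
   and 7/24 of |u|. *)
have Lq u : nrm (L u) <= 1 / 2 * nrm u.
  apply: le_trans (bC (dPQ u)) _.
  have h1 := commutator_dom_estimate s1 (ltac:(lra) : 2 * C <= `|s|) (dPQ u).
  rewrite /P resolventK // -/P in h1.
  have h2 := resolvent_le rsS s0 (Q u); rewrite -/P in h2.
  have h3 := op_resolvent_le rsS s0 (Q u); rewrite -/P in h3.
  have h4 := resolvent_le rsT t0 u; rewrite -/Q in h4.
  have h5 := op_resolvent_le rsT t0 u; rewrite -/Q in h5.
  have n1 := nrm_ge0 (P (Q u)); have n2 := nrm_ge0 (T (P (Q u))).
  have n3 := nrm_ge0 (Q u); have n4 := nrm_ge0 u.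
  have h6 : nrm (P (Q u)) <= nrm (Q u).
    by apply: le_trans h2; rewrite -{1}[nrm _]mul1r ler_wpM2r.
  have h7 : 8 * C * nrm (T (P (Q u))) <= 2 * (nrm u + 2 * C * nrm (Q u)).
    apply: le_trans (_ : 2 * (nrm (T (Q u)) + 2 * C * nrm (Q u)) <= _); last lra.
    by apply: le_trans h1; rewrite ler_wpM2r.
  have h8 : 12 * C * nrm (Q u) <= nrm u.
    by apply: le_trans h4; rewrite ler_wpM2r //; lra.
  have h9 : C * nrm (P (Q u)) <= C * nrm (Q u) by rewrite ler_pM2l.
  have h10 : C * nrm (S (P (Q u))) <= C * nrm (Q u) by rewrite ler_pM2l.
  lra.
(* The right-hand side is (S + i s) v, which (S + i s)^-1 sends back to v. *)
have [u Hu] := neumann (S v + im s *: v) (ltac:(lra) : 0 <= 1 / 2)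
  (ltac:(lra) : 1 / 2 < 1) LB Lq.
suff -> : resolvent T t v = P (Q u) by [].
have [Sx Tx TSx STx] := dPQ u.
apply: (resolvent_uniq rsT t0) => //.
have vE : v = P (S v + im s *: v) by rewrite /P (resolvent_uniq rsS s0 dv erefl).
rewrite [RHS]vE -Hu.
apply/esym; apply: (resolvent_uniq rsS s0); first by apply: domD => //; apply: domZ.
rewrite opfunD ?opfunZ //; last exact: domZ.
have PK : S (P (Q u)) + im s *: P (Q u) = Q u by exact: resolventK.
have QK : T (Q u) + im t *: Q u = u by exact: resolventK.
have := op_commutator_dom s (dPQ u); rewrite PK => CK.
transitivity ((S (T (P (Q u))) + im s *: T (P (Q u))) +
   im t *: (S (P (Q u)) + im s *: P (Q u))); first by lmod.
by rewrite CK PK addrAC QK.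
Qed.

End Bounded.
End WeaklyCommuting.

(** * The adjoint of S + T lies in its closure *)

Section Sum.
Context (R : realType) (B : cstarAlgType R) (E : hilbertModType B).
Implicit Types (x y z u v w : E) (s t e : R).
Context (S T : operator E) (C : R).
Hypotheses (rsS : regular_selfadjoint S) (rsT : regular_selfadjoint T)
  (C0 : 0 < C) (bC : commutator_bound S T C).

Lemma commutator_antisymmetric x v : commutator_dom S T x -> commutator_dom S T v ->
  ⟨commutator S T x | v⟩ = - ⟨x | commutator S T v⟩.
Proof.
move=> [Sx Tx TSx STx] [Sv Tv TSv STv]; rewrite !innerE.
rewrite (rs_symmetric rsS STx Sv) (rs_symmetric rsT TSx Tv).
by rewrite (rs_symmetric rsT Tx TSv) (rs_symmetric rsS Sx STv); lmod.
Qed.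

(** A Yosida-type approximation of the identity: contractive, with values in Dom T, and strongly
    convergent to 1 as t grows. *)
Definition regularization t x := im t *: resolvent T t x.

Lemma regularization_dom t x : t != 0 -> dom T (regularization t x).
Proof. by move=> t0; apply: domZ; exact: resolvent_dom. Qed.

Lemma regularizationE t x : t != 0 -> regularization t x - x = - T (resolvent T t x).
Proof. by move=> t0; rewrite op_resolvent // opprB. Qed.

Lemma regularization_le t x : t != 0 -> nrm (regularization t x) <= nrm x.
Proof. by move=> t0; rewrite nrm_imZ; exact: resolvent_le. Qed.

Lemma regularization_lim x e : 0 < e ->
  exists t1 : R, forall t, t1 <= t -> t != 0 -> nrm (regularization t x - x) <= e.
Proof.
move=> e0; have [t1 t10 H] := op_resolvent_small rsT x e0.
exists t1 => t tt1 t0; rewrite regularizationE // nrmN; apply: H.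
exact: le_trans (ler_norm t).
Qed.

Section AtPoint.
Context (s t0 : R) (x z : E).
Hypotheses (s1 : 1 <= `|s|)
  (invN : resolvent_invariant S T (- s)) (t00 : 0 < t0)
  (invT : forall t, t0 <= `|t| -> forall v, dom S v -> commutator_dom S T (resolvent T t v))
  (adj : forall u, dom S u -> dom T u -> ⟨S u + T u | x⟩ = ⟨u | z⟩).

Let sn0 : s != 0.
Proof. by rewrite -normr_gt0; apply: lt_le_trans s1. Qed.

Let msn0 : - s != 0. Proof. by rewrite oppr_eq0. Qed.

(** With P = (S + i s)^-1, this is formally P T x = P (z - S x), where P S x is read as S P x,
    defined for every x. *)
Let w0 := resolvent S s z - S (resolvent S s x).

(** The adjoint relation [adj] is tested on (S - i s)^-1 y, which [invN] places in both domains. *)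
Let adj_resolvent y : dom T y -> ⟨T (resolvent S (- s) y) | x⟩ = ⟨y | w0⟩.
Proof.
move=> dy; have [Su Tu _ _] := invN dy; have := adj Su Tu.
have R1 a : ⟨resolvent S (- s) y | a⟩ = ⟨y | resolvent S s a⟩.
  by rewrite resolvent_adjoint // opprK.
rewrite innerDl R1 => /(canRL (addKr _)) ->.
rewrite /w0 !(op_resolvent rsS) // !innerE !R1.
by lmod.
Qed.

Let error t y :=
  commutator S T (resolvent T (- t) (resolvent S (- s) y)).

(** Put P = (S - i s)^-1, Q = (T - i t)^-1, x' = Q P y and k = [S,T] x'. Then x' = P Q (y - k). Both
    pairings on the left have the form ⟨- i t T a | x⟩, with a = P Q (y - k) and a = P Q y, so their
    difference only involves k. *)
Let regularized_error t y : t0 <= `|t| -> t != 0 ->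
  ⟨y | resolvent S s (T (regularization t x)) - regularization t w0⟩ =
  - ⟨error t y | regularization t w0⟩.
Proof.
move=> tt0 tn0; have mt0 : t0 <= `|- t| by rewrite normrN.
have mtn0 : - t != 0 by rewrite oppr_eq0.
set u := resolvent S (- s) y.
have du : dom S u by exact: resolvent_dom.
have dx' : commutator_dom S T (resolvent T (- t) u) := invT mt0 du.
set x' := resolvent T (- t) u in dx'; rewrite /error -/u -/x'.
set k := commutator S T x'.
have [Sx Tx TSx STx] := dx'.
pose Q := resolvent T (- t); pose P := resolvent S (- s).
have RT a b : ⟨Q a | b⟩ = ⟨a | resolvent T t b⟩.
  by rewrite /Q resolvent_adjoint // opprK.
have SxE : S x' = Q (S u - k).
  apply/esym; apply: (resolvent_uniq rsT mtn0) => //.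
  have : T x' + im (- t) *: x' = u by exact: resolventK.
  move=> <-; rewrite opfunD ?opfunZ //; last exact: domZ.
  by rewrite /k /commutator; lmod.
have xE : x' = P (Q (y - k)).
  apply/esym; apply: (resolvent_uniq rsS msn0) => //.
  have -> : y - k = (S u - k) + im (- s) *: u.
    by rewrite -(resolventK rsS msn0 y) -/u; lmod.
  by rewrite /Q resolventD // resolventZ // -/(Q _) -SxE.
have E1 : ⟨y | resolvent S s (T (regularization t x))⟩ = ⟨im (- t) *: T x' | x⟩.
  have := resolvent_adjoint rsS y (T (regularization t x)) msn0; rewrite opprK => <-.
  rewrite -/u /regularization opfunZ; last exact: resolvent_dom.
  rewrite !op_resolvent // !innerE -/(Q u) RT.
  by lmod.
have E2 (a : E) : ⟨a | regularization t w0⟩ = ⟨im (- t) *: T (P (Q a)) | x⟩.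
  rewrite innerZr -RT -adj_resolvent; last exact: resolvent_dom.
  by rewrite innerZl; congr (_ *: _); rewrite /im /=; congr Complex; rewrite opprK.
rewrite innerDr innerNr E1 !E2 xE /Q /P resolventB // resolventB //.
rewrite opfunB; last 2 first.
- by have [] := invN (resolvent_dom rsT mtn0 y).
- by have [] := invN (resolvent_dom rsT mtn0 k).
by rewrite !innerE; lmod.
Qed.

(** The commutator estimate is used with S and T interchanged, to bound S x'; the three terms of the
    commutator bound give 1 + (2 + 4 C) + 1. *)
Let error_bounds t y : t0 <= `|t| -> 1 <= `|t| -> 2 * C <= `|t| ->
  nrm (error t y) <= C * (4 + 4 * C) * nrm y /\
  `|t| * nrm (resolvent T (- t) (resolvent S (- s) y)) <= nrm y.
Proof.
move=> tt0 t1 tC; have Cp := C0; have s1' := s1.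
have mt0 : t0 <= `|- t| by rewrite normrN.
have mt1 : 1 <= `|- t| by rewrite normrN.
have mtC : 2 * C <= `|- t| by rewrite normrN.
have mtn0 : - t != 0 by rewrite -normr_gt0; lra.
rewrite /error; set u := resolvent S (- s) y.
have du : dom S u by exact: resolvent_dom.
have dx' : commutator_dom S T (resolvent T (- t) u) := invT mt0 du.
set x' := resolvent T (- t) u in dx' *.
have h1 := bC dx'.
have h2 := resolvent_le rsT mtn0 u; rewrite -/x' normrN in h2.
have h3 := op_resolvent_le rsT mtn0 u; rewrite -/x' in h3.
have := commutator_dom_estimate rsT C0 (commutator_boundC bC) mt1 mtC (commutator_domC dx').
rewrite /x' (resolventK rsT mtn0) -/x' normrN => h4.
have h5 := resolvent_le rsS msn0 y; rewrite -/u normrN in h5.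
have h6 := op_resolvent_le rsS msn0 y; rewrite -/u in h6.
have p1 := nrm_ge0 x'; have p2 := nrm_ge0 u; have p3 := nrm_ge0 (S x').
have h7 : nrm u <= nrm y.
  by apply: le_trans h5; rewrite -{1}[nrm _]mul1r ler_wpM2r.
have h8 : nrm x' <= nrm y.
  apply: le_trans h7; apply: le_trans h2.
  by rewrite -{1}[nrm _]mul1r ler_wpM2r.
split; last exact: le_trans h2 h7.
have h9 : nrm (S x') <= 2 * (nrm (S u) + 2 * C * nrm u).
  by apply: le_trans h4; rewrite -{1}[nrm _]mul1r ler_wpM2r.
have h10 : C * nrm u <= C * nrm y by rewrite ler_pM2l.
apply: le_trans h1 _; rewrite -mulrA ler_pM2l //; lra.
Qed.

(** Testing the error formula on the difference q itself gives |q|^2. Replace w0 by a nearby w1 in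
    both domains: the remainder is small because the error is bounded uniformly in t. For w1,
    antisymmetry moves the commutator onto (T + i t)^-1 w1, where it is O(1/t), and |x'| <=
    |q|/t. *)
Lemma regularized_limit e : dense (dom S `&` dom T) -> 0 < e ->
  exists t1 : R, forall t, t1 <= t -> t != 0 ->
    nrm (resolvent S s (T (regularization t x)) - w0) <= e.
Proof.
move=> dST e0; have Cp := C0.
pose C2 := C * (4 + 4 * C).
have C20 : 0 < C2 by rewrite mulr_gt0 //; lra.
have d0 : 0 < e / (16 * C2 + 1) by rewrite divr_gt0 //; lra.
have [w1 [Sw1 Tw1] w01] := dense_nrm w0 dST d0.
(* Bounds t (|v1| + |S v1| + |T v1|) for v1 = (T + i t)^-1 w1, uniformly in t. *)
pose W := nrm w1 + 2 * (nrm (S w1) + 2 * C * nrm w1) + nrm (T w1).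
have W0 : 0 <= W.
  by rewrite !addr_ge0 ?nrm_ge0 // mulr_ge0 // addr_ge0 ?nrm_ge0 // !mulr_ge0 ?nrm_ge0 ?ltW.
have e2 : 0 < e / 2 by rewrite divr_gt0.
have [t1 Ht1] := regularization_lim w0 e2.
(* A sum exceeding every threshold at once; the absolute value covers a negative [t1]. *)
exists (t1 + `|t1| + t0 + 1 + 2 * C + 16 * (C * W) / e) => t tt1 tn0.
have CW0 : 0 <= 16 * (C * W) / e by rewrite divr_ge0 ?mulr_ge0 // ltW.
have t1p := normr_ge0 t1; have t1n : - t1 <= `|t1| by rewrite -normrN ler_norm.
have t00' := t00.
have tp : 0 < t by lra.
have tE : `|t| = t by rewrite gtr0_norm.
have g0 : t0 <= `|t| by lra.
have g1 : 1 <= `|t| by lra.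
have gC : 2 * C <= `|t| by lra.
have gW : 16 * (C * W) <= e * t.
  by rewrite [e * t]mulrC -ler_pdivrMr //; lra.
have Hw0 : nrm (regularization t w0 - w0) <= e / 2 by apply: Ht1 => //; lra.
set q := resolvent S s (T (regularization t x)) - regularization t w0.
suff Hq : nrm q <= e / 2.
  have -> : resolvent S s (T (regularization t x)) - w0 =
    q + (regularization t w0 - w0) by rewrite /q; lmod.
  by apply: le_trans (nrmD _ _) _; rewrite [leRHS](splitr e) lerD.
have [Herr Hx'] := error_bounds q g0 g1 gC.
set x' := resolvent T (- t) (resolvent S (- s) q) in Hx'.
have dx' : commutator_dom S T x'.
  by apply: invT; [rewrite normrN | exact: resolvent_dom].
pose v1 := resolvent T t w1.
have dv1 : commutator_dom S T v1 by apply: invT.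
have Hv1 : t * nrm (commutator S T v1) <= C * W.
  have := bC dv1; rewrite -(ler_pM2l tp) => /le_trans; apply.
  rewrite mulrCA ler_pM2l // /W.
  have := commutator_dom_estimate rsT C0 (commutator_boundC bC) g1 gC (commutator_domC dv1).
  rewrite /v1 (resolventK rsT tn0) -/v1 tE.
  have := resolvent_le rsT tn0 w1; rewrite -/v1 tE.
  have := resolvent_le rsT tn0 (T w1); rewrite resolvent_op // -/v1 tE.
  lra.
have q0 := nrm_ge0 q.
have E1 : nrm q ^+ 2 = nrm ⟨error t q | regularization t w0⟩.
  by have := regularized_error q g0 tn0; rewrite -/q -nrm_inner => ->; rewrite nrmN.
have E2 : regularization t w0 = regularization t (w0 - w1) + im t *: v1.
  by rewrite /regularization (resolventB rsT tn0 w0 w1) -/v1; lmod.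
have E3 : ⟨error t q | im t *: v1⟩ = - ⟨x' | im t *: commutator S T v1⟩.
  by rewrite !innerZr /error -/x' commutator_antisymmetric // scalerN.
have B1 : nrm ⟨error t q | regularization t (w0 - w1)⟩ <=
    4 * (C2 * nrm q * (e / (16 * C2 + 1))).
  apply: le_trans (inner_bound _ _) _; rewrite ler_pM2l //.
  apply: ler_pM; rewrite ?nrm_ge0 //.
  by apply: le_trans (regularization_le _ tn0) _; exact: ltW.
have B2 : nrm ⟨error t q | im t *: v1⟩ <= 4 * (nrm x' * (C * W)).
  rewrite E3 nrmN; apply: le_trans (inner_bound _ _) _.
  by rewrite nrm_imZ tE ler_pM2l // ler_wpM2l ?nrm_ge0.
have B3 : C2 * (e / (16 * C2 + 1)) <= e / 16.
  rewrite mulrA ler_pdivrMr; last lra.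
  by lra.
have B4 : 16 * (nrm x' * (C * W)) <= e * nrm q.
  apply: le_trans (_ : e * (t * nrm x') <= _); last by rewrite ler_pM2l // -tE.
  by rewrite mulrCA mulrC mulrA ler_wpM2r ?nrm_ge0.
have B5 : nrm q ^+ 2 <= e / 2 * nrm q.
  rewrite E1 E2 innerDr; apply: le_trans (nrmD _ _) _.
  have : C2 * nrm q * (e / (16 * C2 + 1)) <= e / 16 * nrm q.
    by rewrite mulrAC ler_wpM2r.
  lra.
move: B5; have := q0; rewrite le_eqVlt => /orP[/eqP <- _|qp]; first exact: ltW.
by rewrite expr2 ler_pM2r.
Qed.

End AtPoint.

(** With P = (S + i s)^-1, b = i t (T + i t)^-1 x and v = P b, the approximant is u = i s v. In S v
    + T v the terms S P x cancel, so (S + T) u is i s P z, which tends to z, plus errors and i s P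
    [S,T] v, a term of norm at most |[S,T] v|. *)
Lemma adjoint_sum_closure x z : dense (dom S `&` dom T) ->
  (exists2 s0 : R, 0 < s0 & forall s, s0 <= `|s| -> resolvent_invariant S T s) ->
  (forall u, dom S u -> dom T u -> ⟨S u + T u | x⟩ = ⟨u | z⟩) ->
  closure (graph (op_add S T)) (x, z).
Proof.
move=> dST [s0 s00 inv] adj; apply/closure_nrm => e e0 /=; have Cp := C0.
(* The final errors are at most 2 d in the first component and 3 d + 9 C d in the second. *)
pose d := e / (14 * C + 4).
have d0 : 0 < d by rewrite divr_gt0 //; lra.
have [sx sx0 Hsx] := op_resolvent_small rsS x d0.
have [sz sz0 Hsz] := op_resolvent_small rsS z d0.
have nx := nrm_ge0 x; have nz := nrm_ge0 z.
have dx0 : 0 <= nrm x / d by rewrite divr_ge0 // ltW.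
have dz0 : 0 <= nrm z / d by rewrite divr_ge0 // ltW.
(* The last two summands make |x| and |z| at most s d, so that v and P z are of size d. *)
pose s := s0 + sx + sz + 1 + 8 * C + nrm x / d + nrm z / d.
have sp : 0 < s by rewrite /s; lra.
have sE : `|s| = s by rewrite gtr0_norm.
have sn0 : s != 0 by rewrite lt0r_neq0.
have s1 : 1 <= `|s| by rewrite sE /s; lra.
have sC : 8 * C <= `|s| by rewrite sE /s; lra.
have invs : resolvent_invariant S T s by apply: inv; rewrite sE /s; lra.
have invNs : resolvent_invariant S T (- s) by apply: inv; rewrite normrN sE /s; lra.
have {}Hsx : nrm (S (resolvent S s x)) <= d by apply: Hsx; rewrite sE /s; lra.
have {}Hsz : nrm (S (resolvent S s z)) <= d by apply: Hsz; rewrite sE /s; lra.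
have xs : nrm x <= s * d by rewrite -ler_pdivrMr // /s; lra.
have zs : nrm z <= s * d by rewrite -ler_pdivrMr // /s; lra.
have [t0 t00 invT] := resolvent_invariant_swap rsS rsT C0 bC s1 sC invs.
(* With s fixed, t is chosen for precision d / s, because the errors are later multiplied by s. *)
have ds0 : 0 < d / s by rewrite divr_gt0.
have [t1 Ht1] := regularization_lim x ds0.
have [t2 Ht2] := regularized_limit s1 invNs t00 invT adj dST ds0.
pose t := `|t1| + `|t2| + 1.
have t1p := normr_ge0 t1; have t2p := normr_ge0 t2.
have t1l := ler_norm t1; have t2l := ler_norm t2.
have tp : 0 < t by rewrite /t; lra.
have tn0 : t != 0 by rewrite lt0r_neq0.
have {}Ht1 : nrm (regularization t x - x) <= d / s by apply: Ht1 => //; rewrite /t; lra.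
have {}Ht2 := Ht2 t (ltac:(rewrite /t; lra)) tn0.
set b := regularization t x in Ht1 Ht2.
have db : dom T b by exact: regularization_dom.
pose v := resolvent S s b.
have dv : commutator_dom S T v by apply: invs.
have [Sv Tv TSv STv] := dv.
pose k := commutator S T v.
have TvE : T v = resolvent S s (T b + k).
  apply/esym; apply: (resolvent_uniq rsS sn0) => //.
  by rewrite op_commutator_dom // /v resolventK.
have sd : d / s * s = d by rewrite divfK.
set a1 := S (resolvent S s (b - x)).
set a2 := resolvent S s (T b) - (resolvent S s z - S (resolvent S s x)) in Ht2.
have Ha1 : nrm a1 <= d / s by apply: le_trans (op_resolvent_le rsS sn0 _) Ht1.
have bE : x + (b - x) = b by rewrite addrC subrK.
have Hv : s * nrm v <= s * d + d / s.
  rewrite -{1}sE; apply: le_trans (resolvent_le rsS sn0 b) _.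
  by have := nrmD x (b - x); rewrite bE; lra.
have SvE : S v = S (resolvent S s x) + a1.
  rewrite -opfunD; [|exact: resolvent_dom|exact: resolvent_dom].
  by rewrite -resolventD // bE.
have HSv : nrm (S v) <= d + d / s by rewrite SvE; apply: le_trans (nrmD _ _) _; rewrite lerD.
have Tvw : T v = (resolvent S s z - S (resolvent S s x)) + a2 + resolvent S s k.
  by rewrite TvE resolventD // /a2; lmod.
have Hk := bC dv; rewrite -/k in Hk.
have Hrk := resolvent_le rsS sn0 k; rewrite sE in Hrk.
have Hrz := resolvent_le rsS sn0 z; rewrite sE in Hrz.
have rz : nrm (resolvent S s z) <= d by rewrite -(ler_pM2l sp); apply: le_trans Hrz zs.
have v0 := nrm_ge0 v; have Tv0 := nrm_ge0 (T v); have Sv0 := nrm_ge0 (S v).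
have k0 := nrm_ge0 k; have rk0 := nrm_ge0 (resolvent S s k).
have ds1 : d / s <= d by rewrite ler_pdivrMr // ler_peMr ?(ltW d0) // -sE.
have {}Hv : nrm v <= 2 * d.
  have : s * nrm v <= s * (2 * d).
    apply: le_trans Hv _; have : 0 <= (s - 1) * d by rewrite mulr_ge0 // ?(ltW d0) // subr_ge0 -sE.
    lra.
  by rewrite ler_pM2l.
have HTv : nrm (T v) <= 3 * d + nrm (resolvent S s k).
  rewrite Tvw; apply: le_trans (nrmD _ _) _; rewrite lerD2r.
  apply: le_trans (nrmD _ _) _; have := nrmB (resolvent S s z) (S (resolvent S s x)).
  lra.
(* The bound on T v contains |P k|; the factor 8, from 8 C <= s, lets it be absorbed. *)
have Hrk8 : 8 * nrm (resolvent S s k) <= nrm v + nrm (S v) + nrm (T v).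
  have : C * (8 * nrm (resolvent S s k)) <= C * (nrm v + nrm (S v) + nrm (T v)).
    apply: le_trans Hk; apply: le_trans Hrk; rewrite mulrA ler_wpM2r // mulrC -sE //.
  by rewrite ler_pM2l.
have HkC : nrm k <= C * (8 * d + d).
  apply: le_trans Hk _; rewrite ler_pM2l //; lra.
pose u := im s *: v.
have du : dom (op_add S T) u by split; apply: domZ.
have ux : u - x = - S (resolvent S s x) + im s *: resolvent S s (b - x).
  by rewrite op_resolvent // resolventB // /u /v; lmod.
have uz : op_add S T u - z = - S (resolvent S s z) + im s *: (a1 + a2 + resolvent S s k).
  rewrite /= /op_add_fun /u !opfunZ // -scalerDr Tvw SvE.
  by rewrite [S (resolvent S s z)]op_resolvent //; lmod.
have md : d * (14 * C + 4) = e by rewrite divfK // lt0r_neq0 //; lra.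
have Cd : 0 < C * d by rewrite mulr_gt0.
exists (u, op_add S T u); split=> //=.
  rewrite nrmBC ux; apply: le_lt_trans (nrmD _ _) _; rewrite nrmN nrm_imZ.
  have := resolvent_le rsS sn0 (b - x); lra.
rewrite nrmBC [_ - _]uz; apply: le_lt_trans (nrmD _ _) _; rewrite nrmN nrm_imZ sE.
have h1 : nrm (a1 + a2 + resolvent S s k) <= d / s + d / s + nrm (resolvent S s k).
  apply: le_trans (nrmD _ _) _; rewrite lerD2r.
  by apply: le_trans (nrmD _ _) _; rewrite lerD.
have h2 : s * nrm (a1 + a2 + resolvent S s k) <= s * (d / s + d / s + nrm (resolvent S s k)).
  by rewrite ler_pM2l.
have h3 : s * (d / s + d / s + nrm (resolvent S s k)) = 2 * d + s * nrm (resolvent S s k).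
  by field.
lra.
Qed.

End Sum.

(** * From the adjoint to essential self-adjointness *)

Section EssentialSelfadjointness.
Context (R : realType) (B : cstarAlgType R) (E : hilbertModType B).
Implicit Types (x y z u v w : E) (A S T : operator E).

Lemma inner_dense_eq0 (D : set E) w : dense D -> (forall u, D u -> ⟨u | w⟩ = 0) -> w = 0.
Proof.
move=> dD H; apply: nrm0_eq0; apply/le_anti; rewrite nrm_ge0 andbT.
apply/ler_addgt0Pr => e e0; rewrite add0r.
have e4 : 0 < e / 4 by rewrite divr_gt0.
have [u Du wu] := dense_nrm w dD e4.
have : nrm w ^+ 2 <= 4 * (nrm (w - u) * nrm w).
  rewrite -nrm_inner; apply: le_trans (inner_bound _ _).
  by rewrite innerDl innerNl (H _ Du) subr0.
have := nrm_ge0 w; rewrite le_eqVlt => /orP[/eqP <- _|w0]; first exact: ltW.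
rewrite expr2 mulrA ler_pM2r //; lra.
Qed.

Lemma closure_inner_eq (G : set (E * E)) x a y b : closure G (x, a) ->
  (forall q, G q -> ⟨q.2 | y⟩ = ⟨q.1 | b⟩) -> ⟨a | y⟩ = ⟨x | b⟩.
Proof.
move=> /closure_nrm cG H; apply/eqP; rewrite -subr_eq0; apply/eqP/nrm0_eq0/le_anti.
rewrite nrm_ge0 andbT; apply/ler_addgt0Pr => e e0; rewrite add0r.
have y0 := nrm_ge0 y; have b0 := nrm_ge0 b.
have d0 : 0 < e / (4 * (nrm y + nrm b) + 1) by rewrite divr_gt0 //; lra.
have [q [Gq /= q1 q2]] := cG _ d0.
have -> : ⟨a | y⟩ - ⟨x | b⟩ = ⟨a - q.2 | y⟩ - ⟨x - q.1 | b⟩.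
  by rewrite !innerE (H _ Gq); lmod.
apply: le_trans (nrmB _ _) _.
have h1 := inner_bound (a - q.2) y; have h2 := inner_bound (x - q.1) b.
set d := e / _ in d0 q1 q2.
have h3 : nrm (a - q.2) * nrm y <= d * nrm y by rewrite ler_wpM2r // ltW.
have h4 : nrm (x - q.1) * nrm b <= d * nrm b by rewrite ler_wpM2r // ltW.
have h5 : d * (4 * (nrm y + nrm b) + 1) = e by rewrite divfK // lt0r_neq0 //; lra.
lra.
Qed.

Lemma symmetric_closure_adjoint A : symmetric_operator A ->
  closure (graph A) `<=` adjoint_graph A.
Proof.
move=> sA [y z] cA u du /=.
apply: (can_inj (@cstarK _ _)); rewrite !inner_star.
apply/esym; apply: (closure_inner_eq cA) => -[v _] [/= dv ->].
exact: sA.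
Qed.

(** Symmetry gives the reverse inclusion, so the closure is the graph of A^*, single-valued by
    density. An operator is built on it by choice, and its adjoint is again A^*. *)
Lemma essentially_selfadjoint_adjoint A : densely_defined A -> symmetric_operator A ->
  adjoint_graph A `<=` closure (graph A) -> essentially_selfadjoint A.
Proof.
move=> dA sA adjc; split=> //.
have closE : closure (graph A) = adjoint_graph A.
  by apply/seteqP; split=> //; exact: symmetric_closure_adjoint.
have uniq x z z' : adjoint_graph A (x, z) -> adjoint_graph A (x, z') -> z = z'.
  move=> Hz Hz'; apply/eqP; rewrite -subr_eq0; apply/eqP.
  apply: (inner_dense_eq0 dA) => u du.
  by rewrite innerDr innerNr -(Hz u du) -(Hz' u du) subrr.
pose D : set E := [set x | exists z, adjoint_graph A (x, z)].
pose f x := xget 0 [set z | adjoint_graph A (x, z)].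
have fP x : D x -> adjoint_graph A (x, f x) by move=> Dx; exact: (xgetPex 0 Dx).
have fE x z : adjoint_graph A (x, z) -> f x = z.
  by move=> H; apply: (uniq x) => //; apply: fP; exists z.
have adjD x y z w : adjoint_graph A (x, z) -> adjoint_graph A (y, w) ->
    adjoint_graph A (x + y, z + w).
  by move=> H H' u du; rewrite /= !innerDr (H u du) (H' u du).
have adjZ (a : R[i]) x z : adjoint_graph A (x, z) -> adjoint_graph A (a *: x, a *: z).
  by move=> H u du; rewrite /= !innerZr (H u du).
have adjB (b : B) x z : adjoint_graph A (x, z) -> adjoint_graph A (ract x b, ract z b).
  by move=> H u du; rewrite /= !inner_ractr (H u du).
have sD : submodule D.
  split.
  - by exists 0 => u du /=; rewrite !inner0r.
  - by move=> x y /fP Dx /fP Dy; exists (f x + f y); exact: adjD.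
  - by move=> a x /fP Dx; exists (a *: f x); exact: adjZ.
  - by move=> x b /fP Dx; exists (ract (f x) b); exact: adjB.
have fD x y : D x -> D y -> f (x + y) = f x + f y.
  by move=> /fP Dx /fP Dy; apply: fE; exact: adjD.
have fZ (a : R[i]) x : D x -> f (a *: x) = a *: f x.
  by move=> /fP Dx; apply: fE; exact: adjZ.
have fB x (b : B) : D x -> f (ract x b) = ract (f x) b.
  by move=> /fP Dx; apply: fE; exact: adjB.
pose Abar := Build_operator sD fD fZ fB.
have graphE : graph Abar = adjoint_graph A.
  apply/seteqP; split=> [[x z] [/= Dx ->]|[x z] H]; first exact: fP.
  by split=> /=; [exists z | rewrite (fE _ _ H)].
have sub x : dom A x -> D x /\ f x = A x.
  move=> dx; have H : adjoint_graph A (x, A x) by move=> u du /=; exact: sA.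
  by split; [exists (A x) | exact: fE].
exists Abar; split; first by rewrite /is_closure graphE closE.
split.
  move=> O O0 oO; have [y [Oy dy]] := dA O O0 oO.
  by exists y; split=> //; case: (sub y dy).
(* Each pair (u, f u) is a limit of points of the graph of A, so a relation tested on Dom A extends
   to [D]; the converse restricts to Dom A. *)
rewrite /is_adjoint graphE; apply/seteqP; split=> [[y z] H u /= Du|[y z] H u du /=].
  have := fP u Du; rewrite -closE => cu.
  by apply: (closure_inner_eq cu) => -[v _] [/= dv ->]; exact: H.
by have [Du fu] := sub u du; rewrite -fu; exact: (H u Du).
Qed.

Lemma op_add_symmetric S T : regular_selfadjoint S -> regular_selfadjoint T ->
  symmetric_operator (op_add S T).
Proof.
move=> rsS rsT x y [Sx Tx] [Sy Ty]; rewrite /= /op_add_fun !innerE.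
by rewrite (rs_symmetric rsS Sx Sy) (rs_symmetric rsT Tx Ty).
Qed.

Lemma weakly_commuting_resolvent S T (C : R) : regular_selfadjoint S ->
  regular_selfadjoint T -> 0 < C -> commutator_bound S T C -> weakly_commuting S T ->
  exists2 s0 : R, 0 < s0 & forall s, s0 <= `|s| -> resolvent_invariant S T s.
Proof.
move=> rsS rsT C0 bC [_ [D [coreD [l0 l00 H]]]].
exists (l0 + 1 + 2 * C); first by lra.
move=> s Hs; apply: (core_resolvent_invariant rsS rsT C0 bC) coreD _; [lra | lra |].
apply: H => //; rewrite normc_def /= expr0n add0r sqrtr_sqr lecR; lra.
Qed.

End EssentialSelfadjointness.

Theorem proposition2p4 (R : realType) (B : cstarAlgType R)
    (E : hilbertModType B) (S T : operator E)
    (S_regular : regular S) (S_selfadjoint : selfadjoint S)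
    (T_regular : regular T) (T_selfadjoint : selfadjoint T)
    (dense_dom : dense (dom S `&` dom T))
    (S_T_weakly_commuting : weakly_commuting S T) :
  essentially_selfadjoint (op_add S T).
Proof.
have rsS : regular_selfadjoint S by split.
have rsT : regular_selfadjoint T by split.
have [C C0 bC] := weakly_commuting_bound S_T_weakly_commuting.
apply: essentially_selfadjoint_adjoint => //; first exact: op_add_symmetric.
move=> [x z] adj; apply: (adjoint_sum_closure rsS rsT C0 bC) => //.
  exact: weakly_commuting_resolvent bC S_T_weakly_commuting.
by move=> u Su Tu; apply: (adj u); split.
Qed.
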